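(* Let $(l_1,\dots,l_m)$ be the (non-increasing) segment sequence of some unicyclic graph with $l_1\leq 2$, and let $H\in\mathbb{U}(l_1,\dots,l_m)$. (i) If $l_1=2$ and $m\geq 4$, then $\sigma(H)\leq \sigma(U_{l_1,l_2}(l_4,\dots,l_m;l_3))$. (ii) If $l_1=1$ and $m\geq 6$, then $\sigma(H)\leq\sigma(U^1_m)$.
   Context: A unicyclic graph is a connected graph containing exactly one cycle. A segment of a graph $G$ is a path whose end vertices each have degree $1$ or at least $3$ in $G$ and whose internal vertices all have degree $2$ in $G$; its length is its number of edges; the segment sequence of $G$ is the non-increasing sequence of its segment lengths; $\mathbb{U}(l_1,\dots,l_m)$ is the set of unicyclic graphs with segment sequence $(l_1,\dots,l_m)$. A pendent path of length $\ell$ attached at $w$ consists of $\ell$ new vertices $x_1,\dots,x_\ell$ and edges $wx_1,\dots,x_{\ell-1}x_\ell$. For positive integers $a,b$ and nonempty lists $s_1,\dots,s_t$ and $r_1,\dots,r_q$, $U_{a,b}(s_1,\dots,s_t;r_1,\dots,r_q)$ is obtained from the cycle $C_{a+b}$ by choosing two vertices $x,y$ splitting the cycle into paths of lengths $a$ and $b$, attaching pendent paths of lengths $s_1,\dots,s_t$ at $x$ and of lengths $r_1,\dots,r_q$ at $y$. $U^1_n$ is obtained from the triangle $C_3$ by attaching one pendent vertex to each of two of its vertices and $n-5$ pendent vertices to the third vertex. $\sigma(G)$ is the number of independent vertex subsets of $G$, including the empty set. *)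

(* Defs.v *)
(* Simple graphs are symmetric irreflexive relations on a finType. *)
From mathcomp Require Import all_boot.
Set Implicit Arguments. Unset Strict Implicit. Unset Printing Implicit Defensive.

Section Graphs.
Variables (T : finType) (e : rel T).

Definition deg (x : T) : nat := #|[set y | e x y]|.

(* edges are unordered pairs, represented as 2-element sets *)
Definition cycle_edges (s : seq T) : {set {set T}} :=
  [set [set x; next s x] | x in s].

Definition is_cycle (C : {set {set T}}) : Prop :=
  exists s : seq T, [/\ uniq s, 2 < size s, path.cycle e s & C = cycle_edges s].

Definition connected : Prop := forall x y : T, connect e x y.

Definition unicyclic : Prop :=
  connected /\ exists C, is_cycle C /\ forall C', is_cycle C' -> C' = C.

Definition walk_edges (x : T) (p : seq T) : {set {set T}} :=
  [set [set a.1; a.2] | a in zip (x :: p) p].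

(* The walk x, p_1, ..., p_k (k >= 1) is a segment: consecutive vertices adjacent,
   internal vertices distinct, of degree 2 and different from the end vertices,
   end vertices of degree 1 or >= 3.  The end vertices may coincide only if the
   walk is a cycle (length >= 3). *)
Definition is_segment (x : T) (p : seq T) : bool :=
  let y := last x p in
  let int := take (size p).-1 p in
  [&& 0 < size p, path e x p, uniq (x :: int), y \notin int,
      (y != x) || (2 < size p),
      (deg x == 1) || (2 < deg x), (deg y == 1) || (2 < deg y)
    & all (fun v => deg v == 2) int].

Definition is_segE (E : {set {set T}}) : Prop :=
  exists x p, is_segment x p /\ E = walk_edges x p.

Definition segseq (l : seq nat) : Prop :=
  exists L : seq {set {set T}},
    [/\ uniq L, (forall E, E \in L <-> is_segE E),
        sorted geq l & perm_eq l (map (fun E : {set {set T}} => #|E|) L)].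

Definition independent (S : {set T}) : bool :=
  [forall x in S, forall y in S, ~~ e x y].

Definition sigma : nat := #|[set S : {set T} | independent S]|.

End Graphs.

Definition erel (n : nat) (E : seq (nat * nat)) : rel 'I_n :=
  fun i j => ((val i, val j) \in E) || ((val j, val i) \in E).

Definition cyc_edges (k : nat) : seq (nat * nat) :=
  [seq (i, (i.+1) %% k) | i <- iota 0 k].

Definition ppath_edges (w o l : nat) : seq (nat * nat) :=
  if l is 0 then [::] else (w, o) :: [seq (o + i, o + i + 1) | i <- iota 0 l.-1].

Fixpoint pend_edges (w o : nat) (s : seq nat) : seq (nat * nat) :=
  if s is l :: s' then ppath_edges w o l ++ pend_edges w (o + l) s' else [::].

(* U_{a,b}(s;r): cycle C_{a+b} on 0..a+b-1, x = 0, y = a *)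
Definition Uab_n (a b : nat) (s r : seq nat) : nat := a + b + sumn s + sumn r.
Definition Uab (a b : nat) (s r : seq nat) : rel 'I_(Uab_n a b s r) :=
  @erel (Uab_n a b s r)
    (cyc_edges (a + b) ++ pend_edges 0 (a + b) s ++ pend_edges a (a + b + sumn s) r).

Definition U1 (n : nat) : rel 'I_n :=
  @erel n ([:: (0, 1); (1, 2); (2, 0); (0, 3); (1, 4)] ++
          [seq (2, k) | k <- iota 5 (n - 5)]).
Arguments Uab : clear implicits.
Arguments U1 : clear implicits.

(* Main.v *)
(* For weights a, b on the vertices, let Zw W a b be the sum over the independent
   sets I included in W of the products of b v (v in I) and a v (v in W \ I).  A
   vertex v with a single neighbour u in W can be absorbed into the weights of u;
   hence everything off the cycle can be peeled away.  Say that x = (x0, x1) is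
   dominated by X = (X0, X1) if x0 <= X0 and x0 + x1 <= X0 + X1, that is, if
   c0 x0 + c1 x1 <= c0 X0 + c1 X1 whenever c1 <= c0.  Contracting a bridge into a
   pendent segment shows by induction that a tree hanging at v with p segments of
   length 2 and q of length 1 yields weights dominated by (3^p 2^q, 2^p), those of
   p + q pendent paths at v.  The same contraction applies to the segments of the
   cycle, as long as there remain two branch vertices joined by a segment of
   length 2, or a triangle of branch vertices.  The numbers of independent sets of
   these few remaining graphs are explicit and are compared directly. *)
Require Import Defs.
From mathcomp Require Import all_boot.
From mathcomp Require Import zify.
Set Implicit Arguments. Unset Strict Implicit. Unset Printing Implicit Defensive.

(** * Weighted counts of independent sets *)

Definition upd (T : eqType) (f : T -> nat) (u : T) (k : nat) : T -> nat :=
  fun v => if v == u then k else f v.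

Section Weights.
Variables (T : finType) (e : rel T).
Hypotheses (e_sym : symmetric e) (e_irr : irreflexive e).

Definition Zw (W : {set T}) (a b : T -> nat) : nat :=
  \sum_(I : {set T} | (I \subset W) && independent e I)
    \prod_(v in W) (if v \in I then b v else a v).

Lemma sigma_Zw : sigma e = Zw setT (fun=> 1) (fun=> 1).
Proof.
rewrite /sigma /Zw -sum1_card; apply: eq_big => [I|I _]; first by rewrite inE subsetT.
by rewrite big1 // => v _; case: ifP.
Qed.

Lemma eq_Zw (W : {set T}) a b a' b' :
  {in W, a =1 a'} -> {in W, b =1 b'} -> Zw W a b = Zw W a' b'.
Proof.
move=> Ha Hb; apply: eq_bigr => I _; apply: eq_bigr => v vW.
by rewrite Ha ?Hb.
Qed.

Lemma Zw0 a b : Zw set0 a b = 1.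
Proof.
rewrite /Zw (big_pred1 set0) => [|I /=]; first by rewrite big_set0.
rewrite subset0; case: eqP => //= ->; apply/forall_inP => x.
by rewrite inE.
Qed.

Lemma independentP (S : {set T}) :
  reflect {in S &, forall x y, ~~ e x y} (independent e S).
Proof.
apply: (iffP forall_inP) => [H x y xS yS|H x xS]; first exact: (forall_inP (H x xS)).
by apply/forall_inP => y yS; apply: H.
Qed.

Lemma independentU1 v (J : {set T}) :
  independent e (v |: J) = independent e J && [forall w in J, ~~ e v w].
Proof.
apply/independentP/andP => [H|[/independentP H /forall_inP Hv] x y].
  split; first by apply/independentP => x y xJ yJ; apply: H; rewrite !inE ?xJ ?yJ orbT.
  by apply/forall_inP => w wJ; apply: H; rewrite !inE ?eqxx ?wJ ?orbT.
case/setU1P => [->|xJ] /setU1P [->|yJ]; rewrite ?e_irr //; try exact: Hv.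
  by rewrite e_sym Hv.
exact: H.
Qed.

(** Sets avoiding [v] give the first term. Choosing [v] forbids its neighbours; this is encoded by
    giving them weight 0 when chosen rather than by deleting them, so both terms live on
    [W :\ v]. *)
Lemma Zw_split (W : {set T}) a b v : v \in W ->
  Zw W a b = a v * Zw (W :\ v) a b
             + b v * Zw (W :\ v) a (fun w => if e v w then 0 else b w).
Proof.
move=> vW; rewrite {1}/Zw (bigID (fun I : {set T} => v \notin I)) /=; congr addn.
  rewrite /Zw big_distrr; apply: eq_big => [I|I /andP[_ vI]].
    by rewrite subsetD1 -!andbA; congr andb; rewrite andbC.
  by rewrite (big_setD1 v vW) /= (negPf vI).
rewrite (reindex_onto (fun J => v |: J) (fun I => I :\ v)) /=; last first.
  by move=> I /andP[_ /negbNE vI]; rewrite setD1K.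
rewrite /Zw big_distrr /= big_mkcond [RHS]big_mkcond /=; apply: eq_bigr => J _.
rewrite negbK setU11 andbT subUset sub1set vW independentU1 subsetD1 /=.
case JW : (J \subset W) => //=; last first.
case vJ : (v \in J) => /=.
  case: eqP => [E|]; last by rewrite !andbF.
  by move: vJ; rewrite -E !inE eqxx.
have -> : (v |: J) :\ v == J.
  apply/eqP/setP => w; rewrite !inE.
  by case: eqP => //= ->; rewrite vJ.
case iJ : (independent e J) => //=.
rewrite andbT; case: ifP => [/forall_inP H|/negbT].
  rewrite (big_setD1 v vW) /= setU11; congr muln.
  apply: eq_bigr => w; rewrite !inE => /andP [/negPf -> _] /=.
  by case: ifP => // wJ; rewrite (negPf (H w wJ)).
(* Here [J] contains a neighbour [w] of [v]: its term is absent on the left and has the factor 0 at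
   [w] on the right. *)
rewrite negb_forall_in => /exists_inP [w wJ /negPn evw].
have wW : w \in W :\ v.
  rewrite !inE (subsetP JW) // andbT; apply: contraTneq evw => ->.
  by rewrite e_irr.
by rewrite (bigD1 w wW) /= wJ evw mul0n muln0.
Qed.

(** If [u] is out, [v] is free and contributes [a v + b v]; if [u] is in, [v] must be out and
    contributes [a v]. *)
Lemma Zw_peel (W : {set T}) a b u v : u \in W -> v \in W ->
  {in W, forall w, e v w = (w == u)} ->
  Zw W a b = Zw (W :\ v) (upd a u (a u * (a v + b v))) (upd b u (b u * a v)).
Proof.
move=> uW vW Hv; have evu : e v u by rewrite Hv ?eqxx.
have uv : u != v by apply: contraTneq evu => ->; rewrite e_irr.
have uWv : u \in W :\ v by rewrite !inE uv.
rewrite (Zw_split a b vW) !(Zw_split _ _ uWv) /upd eqxx evu mul0n addn0.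
set W' := (W :\ v) :\ u.
have W'P w : w \in W' -> (w == u = false) * (e v w = false).
  by rewrite !inE => /and3P[/negPf wu _ /Hv ->]; rewrite wu.
rewrite (@eq_Zw W' a (fun w => if e v w then 0 else b w) a b) //; last first.
  by move=> w /W'P [_ ->].
rewrite (@eq_Zw W' (fun v0 => if v0 == u then _ else _) _ a b); first last.
- by move=> w /W'P [-> _].
- by move=> w /W'P [-> _].
rewrite (@eq_Zw W' (fun v0 => if v0 == u then _ else _) _ a
   (fun w => if e u w then 0 else b w)); first last.
- by move=> w /W'P [-> _].
- by move=> w /W'P [-> _].
by nia.
Qed.

(* Weights (out, in) of the first vertex of the path t once the rest of the path
   has been absorbed into it; g is the pair of an extra vertex after the last one. *)
Definition chain (a b : T -> nat) (g : nat * nat) (t : seq T) : nat * nat :=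
  foldr (fun v w => (a v * (w.1 + w.2), b v * w.1)) g t.

Lemma eq_chain a b b' g t : {in t, b =1 b'} -> chain a b g t = chain a b' g t.
Proof.
elim: t => //= v t IH H; rewrite IH => [|w wt]; last by rewrite H // inE wt orbT.
by rewrite H // mem_head.
Qed.

Fixpoint induced_path (t : seq T) : bool :=
  if t is v :: r then all (fun w => e v w == (w == head v r)) r && induced_path r
  else true.

Lemma set_cons_D1 (v : T) t : v \notin t -> [set:: v :: t] :\ v = [set:: t].
Proof.
move=> vt; apply/setP => w; rewrite !inE; case: eqP => //= ->.
by rewrite (negPf vt).
Qed.

(** The seed [(1, 0)] is a phantom vertex past the end that is always out. When the first vertex is
    chosen, only the first component of the chain after it survives. *)
Lemma Zw_path t a b : uniq t -> induced_path t ->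
  Zw [set:: t] a b = (chain a b (1, 0) t).1 + (chain a b (1, 0) t).2.
Proof.
elim: t b => [|v r IH] b /=.
  by move=> _ _; rewrite (_ : [set:: [::]] = set0) ?Zw0 //; apply/setP => x; rewrite !inE.
case/andP=> vr ur /andP[/allP Hv Hr].
rewrite (@Zw_split _ a b v) ?inE ?eqxx // set_cons_D1 // !IH //.
case: r vr ur Hv Hr {IH} => [|u r] //= vr /andP[ur _] Hv _.
have evu : e v u by rewrite (eqP (Hv u (mem_head _ _))) eqxx.
rewrite evu mul0n addn0 (@eq_chain a (fun w => if e v w then 0 else b w) b) //.
move=> w wr; rewrite (eqP (Hv w _)) ?inE ?wr ?orbT //.
by case: eqP => // E; rewrite -E wr in ur.
Qed.

(** The cycle is cut at [x]. If [x] is in, both its neighbours are out: the seed [(0, 1)], a chosen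
    phantom after [z], enforces this at [z], and keeping only the first component enforces it at
    [v]. *)
Lemma Zw_cycle x v r z a b : uniq [:: x, v & rcons r z] ->
  induced_path (v :: rcons r z) ->
  {in v :: rcons r z, forall w, e x w = (w == v) || (w == z)} ->
  Zw [set:: [:: x, v & rcons r z]] a b =
    a x * ((chain a b (1, 0) (v :: rcons r z)).1 + (chain a b (1, 0) (v :: rcons r z)).2)
    + b x * (chain a b (0, 1) (v :: rcons r z)).1.
Proof.
move=> Us Hp Hx; have /andP[xt ut] := Us.
rewrite (@Zw_split _ a b x) ?inE ?eqxx // set_cons_D1 // !Zw_path //.
congr (_ + b x * _); rewrite /= Hx ?mem_head // eqxx mul0n addn0.
suff -> : chain a (fun w => if e x w then 0 else b w) (1, 0) (rcons r z)
          = chain a b (0, 1) (rcons r z) by [].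
rewrite /chain !foldr_rcons -!/(chain _ _ _ _) /=.
rewrite Hx ?inE ?mem_rcons ?mem_head ?orbT // eqxx orbT !muln0 mul0n addn0 add0n.
have /andP[vr] := ut; rewrite -/(uniq _) rcons_uniq => /andP[zr _].
apply: eq_chain => w wr; rewrite Hx ?inE ?mem_rcons ?inE ?wr ?orbT //.
case: eqP wr vr => [->|_ wr _]; first by rewrite mem_rcons inE => ->; rewrite orbT.
by case: eqP wr zr => // -> ->.
Qed.

End Weights.

(** * Unicyclic graphs as functional graphs *)

Lemma set2_inj (T : finType) (u v x y : T) :
  [set u; v] = [set x; y] -> (u = x /\ v = y) \/ (u = y /\ v = x).
Proof.
move=> E.
have Hu : u \in [set x; y] by rewrite -E set21.
have Hv : v \in [set x; y] by rewrite -E set22.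
have Hx : x \in [set u; v] by rewrite E set21.
have Hy : y \in [set u; v] by rewrite E set22.
by case/set2P: Hu Hv Hx Hy => -> /set2P[] -> /set2P[] ? /set2P[] ?; subst; auto.
Qed.

Section Structure.
Variables (T : finType) (e : rel T).
Hypotheses (e_sym : symmetric e) (e_irr : irreflexive e).

(** A simple detour between the ends of an edge, avoiding that edge, has an intermediate vertex, so
    the edge closes it to a cycle. *)
Lemma cycle_of_edge x y : e x y ->
  connect (fun u v => e u v && ([set u; v] != [set x; y])) x y ->
  exists2 C, is_cycle e C & [set x; y] \in C.
Proof.
move=> exy /connectP[p0 Hp0 Ey].
case/shortenP: Hp0 Ey => p Hp Up _ Ey.
exists (cycle_edges (x :: p)).
  exists (x :: p); split => //.
    case: p Ey Hp {Up} => [|u [|w p]] //= Ey; first by rewrite Ey e_irr in exy.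
    by rewrite Ey eqxx andbF.
  rewrite /= rcons_path -Ey e_sym exy andbT.
  by apply: sub_path Hp => u v /andP[].
apply/imsetP; exists y; first by rewrite Ey mem_last.
rewrite Ey next_nth mem_last.
by rewrite index_last // nth_default // setUC.
Qed.

(** Take for [h] the distance to [s] and for [par x] the next vertex on a shortest path to [s]. *)
Lemma rank_parent (s : seq T) x0 : x0 \in s -> connected e ->
  exists par : T -> T, exists h : T -> nat,
    forall x, x \notin s -> e x (par x) /\ h (par x) < h x.
Proof.
move=> x0s con.
pose P x n := [exists t : n.-tuple T, path e x t && (last x t \in s)].
have exP x : exists n, P x n.
  have /connectP[p Hp E] := con x x0; exists (size p).
  by apply/existsP; exists (in_tuple p); rewrite Hp -E.
pose h x := ex_minn (exP x).
exists (fun x => odflt x [pick y | e x y && (h y < h x)]), h => x xs.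
case: pickP => [y /andP[] //|H] /=.
suff [y /andP[exy hy]] : exists y, e x y && (h y < h x) by have := H y; rewrite exy hy.
rewrite {2}/h; case: ex_minnP => n /existsP[[t /= /eqP <-]].
case: t => [|y t] /=; first by rewrite (negPf xs).
move=> /andP[/andP[exy pt] Ht] _; exists y; rewrite exy /= ltnS /h.
case: ex_minnP => k _; apply; apply/existsP; exists (in_tuple t).
by rewrite pt.
Qed.

(** Orient the cycle cyclically and every other vertex towards it. Each edge then leaves exactly one
    vertex, and [h] measures the height above the cycle, which makes inductions on the hanging trees
    possible. *)
Lemma unicyclic_functional : unicyclic e ->
  exists s : seq T, exists nxt : T -> T, exists h : T -> nat,
  [/\ uniq s, 2 < size s, {in s, nxt =1 next s},
      forall x, x \notin s -> h (nxt x) < h x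
    & forall x y, e x y = (y == nxt x) || (x == nxt y)].
Proof.
case=> con [C [[s [us s3 cs EC]] HC]].
have [x0 x0s] : exists x0, x0 \in s by case: s s3 {us cs EC} => // x s; exists x; rewrite mem_head.
have [par [h Hpar]] := rank_parent x0s con.
pose nxt x := if x \in s then next s x else par x.
have nxts : {in s, nxt =1 next s} by move=> x xs; rewrite /nxt xs.
have enxt x : e x (nxt x).
  rewrite /nxt; case: ifP => [xs|/negbT /Hpar[] //].
  exact: next_cycle.
have hnxt x : x \notin s -> h (nxt x) < h x.
  by move=> xs; rewrite /nxt (negPf xs); case: (Hpar x xs).
exists s, nxt, h; split=> // x y.
(* f connects everything, so an edge outside f would lie on a second cycle. *)
pose f u v := (v == nxt u) || (u == nxt v).
have f_sym : symmetric f by move=> u v; rewrite /f orbC.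
have f_e u v : f u v -> e u v by case/orP=> /eqP->; rewrite // e_sym.
have cf : path.cycle f s.
  apply: (sub_in_cycle (P := mem s) _ _ (cycle_next us)); last exact/allP.
  by move=> u v us' _ /eqP <-; rewrite /f nxts // eqxx.
have conf0 u : connect f u x0.
  have [n] := ubnP (h u); elim: n u => // n IH u Hn.
  case us' : (u \in s); first exact: (connect_cycle cf).
  apply: (@connect_trans _ _ (nxt u)); first by rewrite connect1 // /f eqxx.
  by apply: IH; apply: leq_trans (hnxt _ (negbT us')) _.
have conf u v : connect f u v.
  by apply: connect_trans (conf0 u) _; rewrite (sym_connect_sym f_sym).
apply/idP/idP; last exact: f_e.
apply: contraLR => nf; apply/negP => exy.
have [C' C'c] : exists2 C, is_cycle e C & [set x; y] \in C.
  apply: cycle_of_edge => //; apply: connect_sub (conf x y) => u v fuv.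
  apply: connect1; rewrite f_e //=; apply/eqP => /set2_inj[][E1 E2].
    by move: nf; rewrite -/(f x y) -E1 -E2 fuv.
  by move: nf; rewrite -/(f x y) f_sym -E1 -E2 fuv.
rewrite (HC _ C'c) EC => /imsetP[z zs /set2_inj[][E1 E2]];
  by move: nf; rewrite E1 E2 -nxts // eqxx ?orbT.
Qed.
End Structure.

(** * Vertices of degree 2 and segments *)

Lemma next_next_neq (T : eqType) (s : seq T) x :
  uniq s -> 2 < size s -> x \in s -> next s (next s x) != x.
Proof.
move=> us s3 xs; have [i s' Es] := rot_to xs.
have us' : uniq (x :: s') by rewrite -Es rot_uniq.
rewrite -!(next_rot i us) Es.
have : 2 < size (x :: s') by rewrite -Es size_rot.
case: s' us' {Es} => [|y [|z s']] //= /and3P[].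
rewrite !inE !negb_or => /and3P[xy xz _] _ _ _.
by rewrite eqxx (eq_sym y x) (negPf xy) eqxx eq_sym.
Qed.

Section DegreeTwo.
Variables (T : finType) (e : rel T).
Hypotheses (e_sym : symmetric e) (e_irr : irreflexive e) (con : connected e).

(** The successor and the predecessor on [c] are distinct, so they exhaust the neighbourhood of
    [v]. *)
Lemma cycle_deg2_closed (c : seq T) v w :
  uniq c -> 2 < size c -> path.cycle e c -> v \in c -> deg e v = 2 -> e v w -> w \in c.
Proof.
move=> uc c3 cc vc dv evw.
have nv : e v (next c v) by apply: next_cycle.
have pv : e v (prev c v) by rewrite e_sym; apply: prev_cycle.
have np : next c v != prev c v.
  apply: contra_neq (next_next_neq uc c3 vc) => ->.
  by rewrite next_prev.
have E : [set next c v; prev c v] = [set y | e v y].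
  apply/eqP; rewrite eqEcard cards2 np -/(deg e v) dv leqnn andbT.
  by apply/subsetP => y /set2P[]->; rewrite inE.
have : w \in [set y | e v y] by rewrite inE.
by rewrite -E => /set2P[]->; rewrite ?mem_next ?mem_prev.
Qed.

(** Take the neighbour [x] of [z1] other than [z2]. If it had degree 2, maximality would put it on
    the path, closing a cycle of vertices of degree 2; such a cycle is a whole component, which [z]
    excludes by connectedness. *)
Lemma deg2_path_extend z1 z2 t z : deg e z != 2 ->
  uniq [:: z1, z2 & t] -> path e z1 (z2 :: t) ->
  all (fun v => deg e v == 2) [:: z1, z2 & t] ->
  (forall w, deg e w = 2 -> e w z1 -> w \in [:: z1, z2 & t]) ->
  exists2 x, e x z1 & deg e x != 2.
Proof.
move=> dz ut pt dt maxt.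
have ez : e z1 z2 by case/andP: pt.
have dz1 : deg e z1 = 2 by case/andP: dt => /eqP.
have [x] : exists x, x \in [set y | e z1 y] :\ z2.
  apply/set0Pn; rewrite -card_gt0.
  by have := cardsD1 z2 [set y | e z1 y]; rewrite -/(deg e z1) dz1 inE ez; lia.
rewrite !inE => /andP[xz2 exz]; exists x; first by rewrite e_sym.
apply/negP => /eqP dx.
have := maxt x dx; rewrite e_sym exz !inE (negPf xz2) => /(_ isT).
case: eqP => [E|_ /= xt]; first by rewrite E e_irr in exz.
case/splitPr: xt ut pt dt {maxt} => t1 t2 ut pt dt.
pose c := z1 :: z2 :: rcons t1 x.
have Ec : [:: z1, z2 & t1 ++ x :: t2] = c ++ t2 by rewrite /c /= cat_rcons.
have uc : uniq c by move: ut; rewrite Ec cat_uniq => /andP[].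
have cc : path.cycle e c.
  rewrite /c /= !rcons_path last_rcons ez (e_sym x) exz andbT /=.
  by move: pt; rewrite /= cat_path /= => /and4P[_ -> ->].
have dc : all (fun v => deg e v == 2) c by move: dt; rewrite Ec all_cat => /andP[].
have cl : fingraph.closed e (mem c).
  apply: intro_closed; first exact: sym_connect_sym.
  move=> a b eab ac; apply: cycle_deg2_closed eab => //.
    by rewrite /c /= size_rcons.
  by apply/eqP; apply: (allP dc).
have zc : z \in c by rewrite -[z \in c](closed_connect cl (con z1 z)) mem_head.
by move: dz; rewrite (allP dc z zc).
Qed.

Lemma deg_gt0 x y : e x y -> 0 < deg e x.
Proof. by move=> exy; rewrite /deg card_gt0; apply/set0Pn; exists y; rewrite inE. Qed.

Lemma not_deg2_end x y : e x y -> deg e x != 2 -> (deg e x == 1) || (2 < deg e x).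
Proof. by move=> /deg_gt0; lia. Qed.

Lemma deg2_path_segment x z1 z2 t y : uniq [:: z1, z2 & t] ->
  path e z1 (z2 :: t) -> all (fun v => deg e v == 2) [:: z1, z2 & t] ->
  e x z1 -> deg e x != 2 -> e y (last z2 t) -> deg e y != 2 ->
  is_segment e x (rcons [:: z1, z2 & t] y) /\
  2 < #|walk_edges x (rcons [:: z1, z2 & t] y)|.
Proof.
move=> ut pt dt exz dx eyz dy.
have notin w : deg e w != 2 -> w \notin [:: z1, z2 & t].
  by apply: contra => /(allP dt).
split.
  have tk : take (size (rcons [:: z1, z2 & t] y)).-1 (rcons [:: z1, z2 & t] y)
            = [:: z1, z2 & t] by rewrite size_rcons -cats1 take_size_cat.
  rewrite /is_segment tk last_rcons size_rcons rcons_path.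
  rewrite cons_uniq ut !notin // dt.
  rewrite (not_deg2_end exz) ?(not_deg2_end eyz) //= orbT.
  by move: pt => /= /andP[-> ->]; rewrite exz e_sym eyz.
(* [head y t] is the vertex following [z2]. The first three edges of the walk are shown to be
   distinct, which also covers the case [x = y]. *)
have zw : head y t \notin [:: z1; z2].
  case: t ut dt notin {pt eyz} => [_ _ /(_ _ dy) //|w' t'] /= ut _ _.
  move: ut; rewrite !inE !negb_or -!andbA => /and5P[_ zw1 _ zw2 _].
  by rewrite eq_sym zw1 eq_sym.
set w := head y t in zw *; have := notin x dx; rewrite !inE !negb_or => /and3P[xz1 xz2 _].
have z12 : z1 != z2 by move: ut; rewrite /= inE negb_or => /andP[/andP[]].
move: zw; rewrite !inE negb_or => /andP[wz1 wz2].
suff: [set [set x; z1]; [set z1; z2]; [set z2; w]]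
      \subset walk_edges x (rcons [:: z1, z2 & t] y).
  move/subset_leq_card; apply: leq_trans.
  rewrite -setUA cardsU1 cards2 !inE !negb_or.
  have -> : [set x; z1] != [set z1; z2].
    apply/eqP => E; have := set21 x z1.
    by rewrite E !inE (negPf xz1) (negPf xz2).
  have -> : [set x; z1] != [set z2; w].
    apply/eqP => E; have := set22 x z1.
    by rewrite E !inE (negPf z12) eq_sym (negPf wz1).
  have -> // : [set z1; z2] != [set z2; w].
  apply/eqP => E; have := set21 z1 z2.
  by rewrite E !inE (negPf z12) eq_sym (negPf wz1).
have mem a b : (a, b) \in zip (x :: rcons [:: z1, z2 & t] y) (rcons [:: z1, z2 & t] y) ->
    [set a; b] \in walk_edges x (rcons [:: z1, z2 & t] y).
  by move=> H; apply/imsetP; exists (a, b).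
apply/subsetP => E; rewrite !inE -orbA => /or3P[]/eqP->; apply: mem => /=.
- by rewrite mem_head.
- by rewrite !inE eqxx orbT.
- by rewrite /w; case: (t) => [|? ?] /=; rewrite !inE !xpair_eqE !eqxx !orbT.
Qed.

Lemma deg2_not_adjacent z : deg e z != 2 ->
  (forall E, is_segE e E -> #|E| <= 2) ->
  forall u v, deg e u = 2 -> deg e v = 2 -> ~~ e u v.
Proof.
(* A maximal path of degree-2 vertices extends to a segment of length at least 3. *)
move=> dz Hseg u v du dv; apply/negP => euv.
pose P n := [exists t : n.-tuple T,
  [&& uniq t, sorted e t & all (fun v => deg e v == 2) t]].
have Pin (t : seq T) : uniq t -> sorted e t -> all (fun v => deg e v == 2) t ->
    P (size t).
  by move=> ut st dt; apply/existsP; exists (in_tuple t); rewrite ut st dt.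
have P2 : P 2.
  apply: (Pin [:: u; v]); rewrite /= ?inE ?euv ?du ?dv ?andbT //.
  by apply: contraTneq euv => ->; rewrite e_irr.
have PT n : P n -> n <= #|T|.
  by case/existsP => t /and3P[/card_uniqP Ht _ _]; rewrite -(size_tuple t) -Ht max_card.
case: (ex_maxnP (ex_intro _ 2 P2) PT) => n /existsP[t /and3P[ut st dt]] maxn.
have n2 := maxn 2 P2.
(* Stated for any rearrangement that is still a path, so that it serves for the path and for its
   reversal, that is, at both ends. *)
have maxc (t' : seq T) : perm_eq t t' -> sorted e t' ->
    forall w, deg e w = 2 -> e w (head u t') -> w \in t'.
  move=> tt' st' w dw ew; apply/negPn/negP => wt'.
  have sz : size t' = n by rewrite -(perm_size tt') size_tuple.
  suff /maxn : P (size (w :: t')) by rewrite /= sz ltnn.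
  apply: (Pin (w :: t')); rewrite /= ?wt' -?(perm_uniq tt') ?dw ?eqxx -?(perm_all _ tt') //.
  by case: (t') st' ew {tt' wt'} => //= a t'' -> ->.
have [z1 [z2 [t' Et]]] : exists z1 z2 t', tval t = [:: z1, z2 & t'].
  case: t {ut st dt maxc} => [[|z1 [|z2 t']]] /= sz; try by rewrite -(eqP sz) in n2.
  by exists z1, z2, t'.
rewrite Et in ut st dt maxc.
have [x exz1 dx] := deg2_path_extend dz ut st dt (maxc _ (perm_refl _) st).
have [y eyz dy] : exists2 y, e y (last z2 t') & deg e y != 2.
  pose r := rev [:: z1, z2 & t'].
  have pr : perm_eq [:: z1, z2 & t'] r by rewrite perm_sym perm_rev.
  have sr : sorted e r.
    by rewrite rev_sorted; rewrite (eq_sorted (e' := e)) // => a b; rewrite e_sym.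
  have := maxc r pr sr.
  have ur : uniq r by rewrite -(perm_uniq pr).
  have dr : all (fun v => deg e v == 2) r by rewrite -(perm_all _ pr).
  have -> : last z2 t' = head u r by rewrite /r -nth0 nth_rev // (last_nth u) /=.
  case: r ur sr dr {pr} (perm_size pr) => [|w1 [|w2 r]] //= ur sr dr _ maxr.
  exact: (deg2_path_extend dz ur sr dr maxr).
have [seg] := deg2_path_segment ut st dt exz1 dx eyz dy.
by rewrite ltnNge Hseg //; exists x, (rcons [:: z1, z2 & t'] y).
Qed.
End DegreeTwo.

(** * Segments read along the orientation [nxt] *)

Section Functional.
Variables (T : finType) (e : rel T) (s : seq T) (nxt : T -> T) (h : T -> nat).
Hypotheses (us : uniq s) (s3 : 2 < size s) (nxts : {in s, nxt =1 next s})
  (hnxt : forall x, x \notin s -> h (nxt x) < h x)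
  (e_nxt : forall x y, e x y = (y == nxt x) || (x == nxt y))
  (e_irr : irreflexive e).

Definition deg2 : {set T} := [set v | deg e v == 2].

Hypothesis deg2_indep : {in deg2 &, forall u v, ~~ e u v}.

Lemma nxt_mem v : v \in s -> nxt v \in s.
Proof. by move=> vs; rewrite nxts // mem_next. Qed.

Lemma e_nxtx x : e x (nxt x).
Proof. by rewrite e_nxt eqxx. Qed.

Lemma nxt_neq x : nxt x != x.
Proof. by apply: contraTneq (e_nxtx x) => ->; rewrite e_irr. Qed.

Lemma nxt_nxt_neq x : nxt (nxt x) != x.
Proof.
case xs : (x \in s); first by rewrite !nxts ?mem_next // next_next_neq.
case ns : (nxt x \in s); first by apply: contraFneq xs => <-; rewrite nxt_mem.
have := hnxt (negbT xs); have := hnxt (negbT ns).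
by case: eqP => // ->; lia.
Qed.

(** The neighbours of [v] are [nxt v] and the preimages of [v]; [nxt v] is no preimage because the
    cycle has length at least 3 and [nxt] descends elsewhere. *)
Lemma deg_nxt v : deg e v = #|[set w | nxt w == v]|.+1.
Proof.
have -> : deg e v = #|nxt v |: [set w | nxt w == v]|.
  by apply: eq_card => w; rewrite !inE e_nxt [v == _]eq_sym.
by rewrite cardsU1 inE nxt_nxt_neq.
Qed.

Lemma deg2_pre v : v \in deg2 -> exists2 w, nxt w = v & forall w', nxt w' = v -> w' = w.
Proof.
rewrite inE deg_nxt => /cards1P[w E]; exists w => [|w' Ew'].
  by apply/eqP; have := set11 w; rewrite -E inE.
by apply/set1P; rewrite -E inE Ew'.
Qed.

Lemma nxt_edge_inj v w : [set v; nxt v] = [set w; nxt w] -> v = w.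
Proof.
by case/set2_inj => -[-> // E]; have := nxt_nxt_neq w; rewrite E eqxx.
Qed.

Lemma deg2_nxt_notin v : v \in deg2 -> nxt v \notin deg2.
Proof.
move=> vD; apply/negP => nD.
by have := deg2_indep vD nD; rewrite e_nxtx.
Qed.

(** As vertices of degree 2 are pairwise non-adjacent, a segment has one or two edges. Read along
    [nxt] it starts at a vertex not of degree 2, which determines it; so segments correspond to the
    complement of [deg2]. *)
Definition segment_from (v : T) : {set {set T}} :=
  if nxt v \in deg2 then [set [set v; nxt v]; [set nxt v; nxt (nxt v)]]
  else [set [set v; nxt v]].

Lemma card_segment_from v : #|segment_from v| = (nxt v \in deg2).+1.
Proof.
rewrite /segment_from; case: ifP => _; last by rewrite cards1.
rewrite cards2; case: eqP => // /nxt_edge_inj E.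
by have := nxt_neq v; rewrite {2}E eqxx.
Qed.

Lemma segment_from_inj : {in [predC deg2] &, injective segment_from}.
Proof.
move=> v w vD wD E.
have : [set v; nxt v] \in segment_from w.
  by rewrite -E /segment_from; case: ifP; rewrite !inE eqxx.
rewrite /segment_from; case: ifP => wn; last by rewrite inE => /eqP/nxt_edge_inj.
case/set2P => /nxt_edge_inj // Ev.
by move: vD; rewrite inE Ev wn.
Qed.

Lemma not_deg2_endpoint v : v \notin deg2 -> (deg e v == 1) || (2 < deg e v).
Proof. by rewrite inE deg_nxt; lia. Qed.

Lemma is_segE_from E : is_segE e E <-> exists2 v, v \notin deg2 & E = segment_from v.
Proof.
split=> [[x [p [Hs ->]]]|[v vD ->]].
  have nd v : (deg e v == 1) || (2 < deg e v) -> v \notin deg2 by rewrite inE; lia.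
  case/and5P: Hs; case: p => [|y [|z [|w p]]] //= _.
  - rewrite andbT e_nxt => exy _ _ /and4P[_ /nd dx /nd dy _].
    have -> : walk_edges x [:: y] = [set [set x; y]].
      apply/setP => E'; apply/imsetP/set1P => [[a]|->]; first by rewrite inE => /eqP-> ->.
      by exists (x, y); rewrite ?inE.
    case/orP: exy => /eqP Ey.
      by exists x; rewrite // /segment_from -Ey (negPf dy).
    by exists y; rewrite // /segment_from -Ey (negPf dx) setUC.
  - rewrite !andbT => /andP[exy eyz] _ _ /and4P[xz /nd dx /nd dz dy0]; have dy : y \in deg2 by rewrite inE.
    have zx : z != x by case/orP: xz.
    have -> : walk_edges x [:: y; z] = [set [set x; y]; [set y; z]].
      apply/setP => E'; apply/imsetP/set2P => [[a]|].
        by rewrite !inE => /orP[]/eqP-> ->; [left|right].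
      by case=> ->; [exists (x, y)|exists (y, z)]; rewrite ?inE ?eqxx ?orbT.
    have [u _ uu] := deg2_pre dy.
    (* The walk goes along [nxt] or against it. The two mixed cases would force [x = z], since [y]
       has one successor and one predecessor. *)
    move: exy eyz; rewrite !e_nxt => /orP[]/eqP Ey /orP[]/eqP Ez.
    + by exists x; rewrite // /segment_from -Ey dy Ez.
    + by rewrite (uu x) // (uu z) // eqxx in zx.
    + by rewrite Ey Ez eqxx in zx.
    + by exists z; rewrite // /segment_from -Ez dy -Ey (setUC [set z] [set y]) (setUC [set y] [set x]) setUC.
  (* A longer walk has two adjacent internal vertices of degree 2. *)
  - move=> /and3P[_ eyz _] _ _ /and4P[_ _ _ /and3P[dy dz _]].
    have : y \in deg2 by rewrite inE.
    by move/deg2_indep => /(_ z); rewrite inE dz eyz => /(_ isT).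
rewrite /segment_from; case: ifP => nD.
  exists v, [:: nxt v; nxt (nxt v)]; split.
    rewrite /is_segment /= !e_nxtx !inE !not_deg2_endpoint ?deg2_nxt_notin //.
    rewrite eq_sym nxt_neq nxt_neq nxt_nxt_neq /=.
    by move: nD; rewrite inE => ->.
  apply/setP => E'; apply/set2P/imsetP.
    by case=> ->; [exists (v, nxt v)|exists (nxt v, nxt (nxt v))]; rewrite ?inE ?eqxx ?orbT.
  by case=> a; rewrite !inE => /orP[]/eqP-> ->; [left|right].
exists v, [:: nxt v]; split.
  rewrite /is_segment /= e_nxtx nxt_neq !not_deg2_endpoint // ?nD //.
apply/setP => E'; apply/set1P/imsetP => [->|[a]]; first by exists (v, nxt v); rewrite ?inE.
by rewrite inE => /eqP-> ->.
Qed.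

Lemma card_nxt_deg2 : #|[set v in ~: deg2 | nxt v \in deg2]| = #|deg2|.
Proof.
set A := [set v in _ | _].
have AE v : (v \in A) = (v \notin deg2) && (nxt v \in deg2) by rewrite in_set in_setC.
have <- : nxt @: A = deg2.
  apply/setP => d; apply/imsetP/idP => [[v]|dD]; first by rewrite AE => /andP[_ H] ->.
  have [w Ew _] := deg2_pre dD; exists w; rewrite // AE Ew dD andbT.
  by apply/negP => /deg2_nxt_notin; rewrite Ew dD.
rewrite card_in_imset // => v w; rewrite !AE => /andP[_ vD] _ E.
have [u _ uu] := deg2_pre vD.
by rewrite (uu v) // (uu w).
Qed.

(** Segments of length 2 correspond to their middle vertices, and [q] counts those of length 1. The
    [#|deg2| + q] starting vertices and the middle vertices make up [T]. *)
Lemma segseq_nseq l : segseq e l -> exists q,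
  #|T| = 2 * #|deg2| + q /\ l = nseq #|deg2| 2 ++ nseq q 1.
Proof.
case=> L [uL HL sl pl].
pose D1 := [set v in ~: deg2 | nxt v \in deg2].
pose D0 := [set v in ~: deg2 | nxt v \notin deg2].
have cD : #|~: deg2| = #|deg2| + #|D0|.
  rewrite -card_nxt_deg2 -(cardsID [set v | nxt v \in deg2] (~: deg2)).
  by congr (_ + _); apply: eq_card => v; rewrite !inE // andbC.
exists #|D0|; split.
  by rewrite -(cardsC deg2) cD; lia.
have pL : perm_eq L [seq segment_from v | v <- enum (~: deg2)].
  apply: uniq_perm => // [|E].
    rewrite map_inj_in_uniq ?enum_uniq // => v w.
    rewrite !mem_enum !inE => vD wD; apply: segment_from_inj; rewrite !inE; lia.
  apply/idP/mapP => [/HL/is_segE_from[v vD ->]|[v]].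
    by exists v; rewrite // mem_enum inE.
  by rewrite mem_enum inE => vD ->; apply/HL/is_segE_from; exists v.
apply: (sorted_eq (leT := geq)) => //; first by move=> a b c /= ab /leq_trans; apply.
- by move=> a b /=; rewrite andbC; apply: anti_leq.
- elim: #|deg2| => [|n IH] /=; first by elim: #|D0| => //= -[|n].
  rewrite path_sortedE ?IH ?andbT; last by move=> a b c /= ab /leq_trans; apply.
  by rewrite all_cat !all_nseq /= !orbT.
apply: (perm_trans pl); apply: perm_trans (perm_map _ pL) _.
rewrite -map_comp.
rewrite (eq_map (g := fun v => (nxt v \in deg2).+1)); last exact: card_segment_from.
apply/allP => k _ /=; rewrite count_cat !count_nseq count_map.
have cnt (P : pred T) : count P (enum (~: deg2)) = #|[set v in ~: deg2 | P v]|.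
  rewrite -size_filter.
  have /card_uniqP <- : uniq (filter P (enum (~: deg2))) by rewrite filter_uniq ?enum_uniq.
  by apply: eq_card => v; rewrite mem_filter mem_enum !inE andbC.
rewrite cnt -card_nxt_deg2 -/D1.
case: k => [|[|[|k]]] /=; rewrite ?mul0n ?mul1n ?addn0 ?add0n.
- by rewrite cards_eq0; apply/eqP/setP => v; rewrite !inE; lia.
- by apply/eqP; apply: eq_card => v; rewrite !inE; case: (deg e (nxt v) == 2).
- by apply/eqP; apply: eq_card => v; rewrite !inE; case: (deg e (nxt v) == 2).
- by rewrite cards_eq0; apply/eqP/setP => v; rewrite !inE; lia.
Qed.

End Functional.

(** * Domination and peeling *)

Definition dom (x X : nat * nat) : Prop := x.1 <= X.1 /\ x.1 + x.2 <= X.1 + X.2.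

(* Weights (out, in) of a vertex carrying p pendent paths of length 2 and q of
   length 1. *)
Definition star (p q : nat) : nat * nat := (3 ^ p * 2 ^ q, 2 ^ p).

(* Contribution of a neighbour with weights w to the vertex above it. *)
Definition up (w : nat * nat) : nat * nat := (w.1 + w.2, w.1).

Definition pmul (y w : nat * nat) : nat * nat := (y.1 * w.1, y.2 * w.2).

Lemma dom_refl x : dom x x.
Proof. by []. Qed.

(** Write [c0 * x.1 + c1 * x.2] as [(c0 - c1) * x.1 + c1 * (x.1 + x.2)]. *)
Lemma dom_context c0 c1 x X : c1 <= c0 -> dom x X ->
  c0 * x.1 + c1 * x.2 <= c0 * X.1 + c1 * X.2.
Proof.
case: x X => x0 x1 [X0 X1] c10 [/= H1 H2].
rewrite -(subnK c10) !mulnDl -!addnA -!mulnDr leq_add //.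
  by rewrite leq_mul.
by rewrite leq_mul.
Qed.

(** Replace first [w] by [W] with coefficients [y], then [y] by [Y] with coefficients [W]; the order
    explains which two pairs must be decreasing. *)
Lemma dom_mul y Y w W : y.2 <= y.1 -> W.2 <= W.1 ->
  dom y Y -> dom w W -> dom (pmul y w) (pmul Y W).
Proof.
move=> Hy HW yY wW; split => /=; first by apply: leq_mul; [case: yY|case: wW].
apply: leq_trans (dom_context Hy wW) _.
by rewrite ![_ * W.1]mulnC ![_ * W.2]mulnC; apply: dom_context.
Qed.

(** This contracts a bridge: what hung below it moves to the upper vertex, together with a new
    pendent edge, whose factors are 2 and 1. The totals agree for [w = W]. The next lemma does the
    same for a segment of length 2, with factors 3 and 2. *)
Lemma dom_up1 w W : W.2 <= W.1 -> dom w W -> dom (up w) (2 * W.1, W.2).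
Proof. by case: w W => w0 w1 [W0 W1] /= H [/= H1 H2]; split => /=; lia. Qed.

Lemma dom_up2 w W : W.2 <= W.1 -> dom w W -> dom (up (up w)) (3 * W.1, 2 * W.2).
Proof. by case: w W => w0 w1 [W0 W1] /= H [/= H1 H2]; split => /=; lia. Qed.

Lemma star_le p q : (star p q).2 <= (star p q).1.
Proof. by rewrite /= -[2 ^ p]muln1 leq_mul ?expn_gt0 //; case: p => // p; rewrite leq_exp2r. Qed.

Lemma starD p q p' q' : pmul (star p q) (star p' q') = star (p + p') (q + q').
Proof. by rewrite /pmul /star /= !expnD; congr pair; lia. Qed.

Lemma starSl p q : star p.+1 q = (3 * (star p q).1, 2 * (star p q).2).
Proof. by rewrite /star /= !expnS mulnA. Qed.

Lemma starSr p q : star p q.+1 = (2 * (star p q).1, (star p q).2).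
Proof. by rewrite /star /= expnS mulnCA. Qed.

Lemma dom_star_up1 p q w : dom w (star p q) -> dom (up w) (star p q.+1).
Proof.
move=> H; rewrite starSr.
by apply: dom_up1; rewrite ?star_le.
Qed.

Lemma dom_star_up2 p q w : dom w (star p q) -> dom (up (up w)) (star p.+1 q).
Proof.
move=> H; rewrite starSl.
by apply: dom_up2; rewrite ?star_le.
Qed.

(** * Absorbing the hanging trees into the cycle *)

Section Peel.
Variables (T : finType) (e : rel T) (s : seq T) (nxt : T -> T) (h : T -> nat).
Hypotheses (us : uniq s) (s3 : 2 < size s) (nxts : {in s, nxt =1 next s})
  (hnxt : forall x, x \notin s -> h (nxt x) < h x)
  (e_nxt : forall x y, e x y = (y == nxt x) || (x == nxt y))
  (e_irr : irreflexive e)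
  (deg2_indep : {in deg2 e &, forall u v, ~~ e u v}).

Definition pre_in (W : {set T}) (v : T) : bool := [forall w, (nxt w == v) ==> (w \in W)].

Lemma pre_inP (W : {set T}) v : reflect (forall w, nxt w = v -> w \in W) (pre_in W v).
Proof.
apply: (iffP forallP) => [H w /eqP E|H w]; first exact: implyP (H w) E.
by apply/implyP => /eqP; apply: H.
Qed.

(* State of a vertex v of W when the complement of W has been absorbed, the pair x
   being its weights, m the number of vertices of degree 2 absorbed in it (itself
   included) and n the number of all such vertices.  A vertex of degree 2 is either
   untouched or half of a segment whose lower end has weights w. *)
Definition peeled (W : {set T}) (v : T) (x : nat * nat) (m n : nat) : Prop :=
  if v \in deg2 e then
    if pre_in W v then [/\ x = (1, 1), m = 1 & n = 1]
    else exists w p q,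
      [/\ dom w (star p q), w.2 <= w.1, x = up w, m = p.+1 & n = 2 * p + q + 2]
  else exists p q, [/\ dom x (star p q), x.2 <= x.1, m = p, n = 2 * p + q + 1
    & p + q = 0 -> pre_in W v].

Lemma functional_sym : symmetric e.
Proof. by move=> x y; rewrite !e_nxt orbC. Qed.

Lemma peeled_init v : peeled setT v (1, 1) (v \in deg2 e) 1.
Proof.
have H : pre_in setT v by apply/pre_inP => w; rewrite inE.
by rewrite /peeled H; case: (v \in deg2 e) => //; exists 0, 0.
Qed.

(** If [v] has degree 2, the whole segment through it is contracted into [u]. If [u] has degree 2,
    [u] merely becomes half of a segment. Otherwise the bridge from [v] to [u] is contracted. *)
Lemma peeled_step (W : {set T}) v a b m n :
  v \in W -> (forall w, w \in W -> nxt w != v) -> nxt v \in W ->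
  (forall w, w \in W -> peeled W w (a w, b w) (m w) (n w)) ->
  let u := nxt v in
  forall w, w \in W :\ v ->
  peeled (W :\ v) w (upd a u (a u * (a v + b v)) w, upd b u (b u * a v) w)
    (upd m u (m u + m v) w) (upd n u (n u + n v) w).
Proof.
move=> vW leaf uW Hp u w; rewrite in_setD1 => /andP[wv wW].
rewrite /upd; case: eqP => [->|wu]; last first.
  have E : pre_in (W :\ v) w = pre_in W w.
    apply: eq_forallb => z; rewrite in_setD1.
    by case: (z =P v) => [->|]; rewrite //= -/u; case: eqP => // E; rewrite E in wu.
  by have := Hp w wW; rewrite /peeled E.
have nE : pre_in (W :\ v) u = false.
  by apply/pre_inP => /(_ v erefl); rewrite in_setD1 eqxx.
have := Hp v vW; have := Hp u uW; rewrite /peeled nE -/u.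
have uv : [&& u \in deg2 e & v \in deg2 e] = false.
  apply/negP => /andP[uD vD].
  by have := deg2_indep vD uD; rewrite e_nxt eqxx.
case vD : (v \in deg2 e).
  rewrite vD andbT in uv; rewrite uv.
  (* [v] has a predecessor but is a leaf of [W], so that predecessor has been absorbed already. *)
  have -> : pre_in W v = false.
    apply/pre_inP => Hv.
    have [z zv _] := deg2_pre us s3 nxts hnxt e_nxt vD.
    by have := leaf z (Hv z zv); rewrite zv eqxx.
  move=> [pu [qu [Du Lu -> -> _]]] [x [p [q [D L [Ea Eb] -> ->]]]].
  exists (pu + p.+1), (qu + q); split; try lia.
    rewrite Ea Eb -starD.
    exact: (dom_mul (y := (a u, b u)) Lu (star_le _ _) Du (dom_star_up2 D)).
  by rewrite /= Ea Eb leq_mul // leq_addr.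
move=> Hu [p [q [D L -> -> _]]]; move: Hu.
case uD : (u \in deg2 e).
  (* The only predecessor of [u] is [v], still present, so [u] is untouched. *)
  have -> : pre_in W u.
    apply/pre_inP => z zu.
    have [z' _ zz] := deg2_pre us s3 nxts hnxt e_nxt uD.
    by rewrite (zz z) // -(zz v).
  by case=> -[-> ->] -> ->; exists (a v, b v), p, q; rewrite /up !mul1n; split=> //; lia.
move=> [pu [qu [Du Lu -> -> _]]].
exists (pu + p), (qu + q.+1); split; try lia.
  rewrite -starD.
  exact: (dom_mul (y := (a u, b u)) Lu (star_le _ _) Du (dom_star_up1 D)).
by rewrite /= leq_mul // leq_addr.
Qed.

Lemma sum_upd (W : {set T}) u v (m : T -> nat) : v \in W -> u \in W -> u != v ->
  \sum_(w in W :\ v) upd m u (m u + m v) w = \sum_(w in W) m w.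
Proof.
move=> vW uW uv; have uWv : u \in W :\ v by rewrite in_setD1 uv.
rewrite [RHS](big_setD1 v) //= [in RHS](big_setD1 u) //= (big_setD1 u) //=.
rewrite /upd eqxx [X in _ + X](_ : _ = \sum_(w in (W :\ v) :\ u) m w); first lia.
by apply: eq_bigr => w; rewrite !inE => /andP[/negPf ->].
Qed.

(** A vertex of [W] of maximal height off the cycle is a leaf of [W] and can be peeled. The sums of
    [m] and [n] are preserved, which keeps count of the vertices of degree 2 and of all vertices. *)
Lemma peel_to_cycle (W : {set T}) a b m n :
  {subset s <= W} -> (forall w, w \in W -> nxt w \in W) ->
  (forall w, w \in W -> peeled W w (a w, b w) (m w) (n w)) ->
  exists a' b' m' n', [/\
    forall w, w \in s -> peeled [set:: s] w (a' w, b' w) (m' w) (n' w),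
    Zw e W a b = Zw e [set:: s] a' b',
    \sum_(w in W) m w = \sum_(w <- s) m' w &
    \sum_(w in W) n w = \sum_(w <- s) n' w].
Proof.
have [k] := ubnP #|W|; elim: k W a b m n => // k IH W a b m n Hk sW Wn Hp.
have [WE|] := boolP (W :\: [set:: s] == set0).
  have {WE} WE : W = [set:: s].
    apply/eqP; rewrite eqEsubset -setD_eq0 WE; apply/subsetP => w.
    by rewrite inE; apply: sW.
  have Es f : \sum_(w in W) f w = \sum_(w <- s) f w.
    by rewrite WE (big_uniq _ us); apply: eq_bigl => w; rewrite inE.
  exists a, b, m, n; rewrite -WE; split => // w ws.
  by apply: Hp; apply: sW.
case/set0Pn => v0 Hv0.
case: (arg_maxnP (P := fun x => x \in W :\: [set:: s]) h Hv0) => v Hv maxv.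
have /andP[vs vW] : (v \notin s) && (v \in W) by move: Hv; rewrite !inE.
have leaf w : w \in W -> nxt w != v.
  move=> wW; apply/eqP => E.
  have ws : w \notin s by apply: contra vs => ws; rewrite -E nxts // mem_next.
  have /maxv : w \in W :\: [set:: s] by rewrite !inE ws.
  by have := hnxt ws; rewrite E; lia.
have uW := Wn v vW.
have uv : nxt v != v by apply: nxt_neq e_nxt e_irr _.
have Hstep := peeled_step vW leaf uW Hp.
case: (IH (W :\ v) _ _ _ _ _ _ _ Hstep) => [|w ws|w|].
- by rewrite (cardsD1 v) vW in Hk; lia.
- by rewrite in_setD1 sW // andbT; apply: contraNneq vs => <-.
- by rewrite !in_setD1 => /andP[_ wW]; rewrite leaf // Wn.
move=> a' [b' [m' [n' [H1 H2 H3 H4]]]]; exists a', b', m', n'; split => //.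
- rewrite -H2; apply: Zw_peel => //; first exact: functional_sym.
  by move=> w wW; rewrite e_nxt [v == _]eq_sym (negPf (leaf w wW)) orbF.
- by rewrite -H3 sum_upd.
- by rewrite -H4 sum_upd.
Qed.

Lemma peeled_cycle_deg2 v x m n : v \in s -> v \in deg2 e ->
  peeled [set:: s] v x m n -> [/\ x = (1, 1), m = 1 & n = 1].
Proof.
move=> vs vD; rewrite /peeled vD.
have -> // : pre_in [set:: s] v.
apply/pre_inP => z zv; rewrite inE.
have [z' _ zz] := deg2_pre us s3 nxts hnxt e_nxt vD.
rewrite (zz z) // -(zz (prev s v)) ?mem_prev //.
by rewrite nxts ?mem_prev // next_prev.
Qed.

(** With [p + q = 0] all preimages of [v] would lie on the cycle, leaving only [prev s v], and [v]
    would have degree 2. *)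
Lemma peeled_cycle_branch v x m n : v \in s -> v \notin deg2 e ->
  peeled [set:: s] v x m n ->
  exists p q, [/\ dom x (star p q), x.2 <= x.1, m = p, n = 2 * p + q + 1 & 0 < p + q].
Proof.
move=> vs vD; rewrite /peeled (negPf vD) => -[p [q [D L Em En H]]].
exists p, q; split => //; rewrite lt0n; apply/eqP => /H /pre_inP Hv.
move: vD; rewrite inE (deg_nxt us s3 nxts hnxt e_nxt) eqSS.
suff -> : [set w | nxt w == v] = [set prev s v] by rewrite cards1.
apply/setP => w; rewrite !inE; apply/eqP/eqP => [E|->]; last first.
  by rewrite nxts ?mem_prev // next_prev.
have := Hv w E; rewrite inE => ws.
by rewrite -E nxts // prev_next.
Qed.
End Peel.

(** * The weighted count on the cycle *)

Section Cycle.
Variables (T : finType) (e : rel T).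

Lemma induced_path_nth x0 t : uniq t ->
  (forall i j, i < j < size t -> e (nth x0 t i) (nth x0 t j) = (j == i.+1)) ->
  induced_path e t.
Proof.
elim: t => //= v r IH /andP[vr ur] H; apply/andP; split; last first.
  by apply: IH => // i j ij; apply: (H i.+1 j.+1).
apply/allP => w wr; have [k kr <-] : exists2 k, k < size r & nth x0 r k = w.
  by exists (index w r); rewrite ?index_mem ?nth_index.
rewrite (H 0 k.+1) // -nth0 (set_nth_default x0 v) ?(leq_ltn_trans _ kr) //.
by rewrite nth_uniq ?(leq_ltn_trans _ kr) // eqSS.
Qed.

Lemma cycle_nth x t : uniq (x :: t) -> 1 < size t ->
  {in x :: t &, forall u w, e u w = (w == next (x :: t) u) || (u == next (x :: t) w)} ->
  forall i j, i < j < size (x :: t) ->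
  e (nth x (x :: t) i) (nth x (x :: t) j) = (j == i.+1) || ((i == 0) && (j == size t)).
Proof.
move=> us t2 He i j /andP[ij js]; have is' := ltn_trans ij js.
(* For the last index, [nth] falls back on its default [x], which is exactly the wrap-around of the
   cycle. *)
have nx k : k < size (x :: t) ->
    next (x :: t) (nth x (x :: t) k) = nth x (x :: t) k.+1.
  by move=> ks; rewrite next_nth mem_nth // index_uniq.
rewrite He ?mem_nth // !nx // nth_uniq ?(leq_trans _ js) //; congr orb.
have := js; rewrite /= ltnS leq_eqVlt => /predU1P[jt|jt].
  rewrite jt eqxx andbT [X in _ == X]nth_default //.
  by rewrite -[X in _ == X]/(nth x (x :: t) 0) nth_uniq.
rewrite -[nth x t j]/(nth x (x :: t) j.+1) nth_uniq // (ltn_eqF jt) andbF.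
by apply/eqP; lia.
Qed.

Lemma Zw_next_cycle x t a b : symmetric e -> irreflexive e ->
  uniq (x :: t) -> 1 < size t ->
  {in x :: t &, forall u w, e u w = (w == next (x :: t) u) || (u == next (x :: t) w)} ->
  Zw e [set:: x :: t] a b =
    a x * ((chain a b (1, 0) t).1 + (chain a b (1, 0) t).2) + b x * (chain a b (0, 1) t).1.
Proof.
move=> e_sym e_irr us t2 He; have Hn := cycle_nth us t2 He.
have ut : uniq t by case/andP: us.
have ip : induced_path e t.
  apply: (induced_path_nth (x0 := x)) => // i j /andP[ij js].
  by rewrite (Hn i.+1 j.+1) ?orbF //= !ltnS ij.
have Hx k : k < size t -> e x (nth x t k) = (k == 0) || (k.+1 == size t).
  by move=> kt; rewrite (Hn 0 k.+1).
case: t us t2 ut ip Hx {He Hn} => // v r.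
case: (lastP r) => // {}r z us _ ut ip Hx.
apply: Zw_cycle => // w wt.
rewrite -(nth_index x wt) Hx ?index_mem //.
congr orb.
  by rewrite -(nth_uniq x _ _ ut) ?index_mem.
have zs : (size r).+1 < size (v :: rcons r z) by rewrite /= size_rcons.
rewrite [size _](_ : _ = (size r).+2) ?eqSS; last by rewrite /= size_rcons.
rewrite -(nth_uniq x _ zs ut) ?index_mem //=.
by rewrite nth_rcons ltnn eqxx.
Qed.
End Cycle.

(** * Contracting the segments along the cycle *)

Section Chain.
Variables (T : finType) (D : {set T}) (a b m n : T -> nat).

Definition starred (v : T) : Prop :=
  if v \in D then [/\ (a v, b v) = (1, 1), m v = 1 & n v = 1]
  else exists p q, [/\ dom (a v, b v) (star p q), b v <= a v, m v = p,
    n v = 2 * p + q + 1 & 0 < p + q].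

Lemma chain_cons g v t : chain a b g (v :: t) = pmul (a v, b v) (up (chain a b g t)).
Proof. by []. Qed.

(** All segments inside the path are contracted into one branch vertex carrying [star P Q]. Only the
    segment leaving the last branch vertex remains, of length 2 or 1 according to whether the path
    ends in [D]. The bound holds for every [g] because both seeds of the cycle formula are needed
    with the same [P] and [Q]. *)
Lemma chain_dom y r : y \notin D -> {in y :: r, forall v, starred v} ->
  path (fun u v => ~~ ((u \in D) && (v \in D))) y r ->
  exists P Q, [/\ 0 < P + Q,
    \sum_(v <- y :: r) m v = P + (last y r \in D),
    \sum_(v <- y :: r) n v = 2 * P + Q + 1 + (last y r \in D) &
    forall g, dom (chain a b g (y :: r))
      (pmul (star P Q) (if last y r \in D then up (up g) else up g))].
Proof.
have [k] := ubnP (size r); elim: k y r => // k IH y r Hk yD Hs Hp.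
have := Hs y (mem_head _ _); rewrite /starred (negPf yD).
move=> [p [q [Dy Ly my ny pq]]].
have Gle (c : bool) g : (if c then up (up g) else up g).2 <= (if c then up (up g) else up g).1.
  by case: c; rewrite leq_addr.
have Wle P Q c g : (pmul (star P Q) (if c then up (up g) else up g)).2 <=
    (pmul (star P Q) (if c then up (up g) else up g)).1.
  by apply: leq_mul; [apply: star_le|apply: Gle].
have Dmul P Q w g G : w.2 <= w.1 -> dom w (pmul (star P Q) G) -> G.2 <= G.1 ->
    g = pmul (a y, b y) w -> dom g (pmul (star (p + P) (q + Q)) G).
  move=> _ Dw HG ->; rewrite -starD.
  have -> : pmul (pmul (star p q) (star P Q)) G = pmul (star p q) (pmul (star P Q) G).
    by rewrite /pmul /=; congr pair; lia.
  by apply: dom_mul => //; apply: leq_mul; rewrite ?star_le.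
case: r Hk Hs Hp => [|z r] Hk Hs Hp.
  exists p, q; rewrite !big_seq1 my ny /= (negPf yD); split=> //; try lia.
  move=> g; rewrite /chain /= -/(up g).
  exact: (dom_mul (y := (a y, b y)) (w := up g) Ly (Gle false g) Dy (dom_refl _)).
have Hz := Hs z; rewrite !inE eqxx orbT /starred in Hz; have {Hz} Hz := Hz isT.
have Hs' : {in z :: r, forall v, starred v}.
  by move=> v vr; apply: Hs; rewrite inE vr orbT.
have {Hp} Hp : path (fun u v => ~~ ((u \in D) && (v \in D))) z r by case/andP: Hp.
have [zD|zD] := boolP (z \in D); last first.
  (* Two consecutive branch vertices: contracting the edge between them adds a pendent path of
     length 1. *)
  have [P [Q [PQ Em En Dch]]] := IH z r Hk zD Hs' Hp.
  exists (p + P), (q + Q.+1); rewrite !(big_cons _ _ y) Em En my ny.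
  rewrite -[last y (z :: r)]/(last z r); split; try lia.
  move=> g; apply: (Dmul P Q.+1 (up (chain a b g (z :: r)))) => //.
    by rewrite leq_addr.
  have := dom_up1 (Wle P Q _ _) (Dch g).
  rewrite (_ : (2 * _, _) = pmul (star P Q.+1) (if last z r \in D then up (up g) else up g)) //.
  by rewrite /pmul /star /= expnS; congr pair; lia.
move: Hz; rewrite zD => -[[az bz] mz nz].
(* Now [z] lies in [D]. If it is last, its segment survives as [up (up g)]; otherwise the segment
   from [y] through [z] to [w] is contracted and [P] grows by one. *)
case: r Hk Hs Hp Hs' => [|w r] Hk Hs Hp Hs'.
  exists p, q; rewrite !big_cons !big_nil my ny mz nz /= zD; split=> //; try lia.
  move=> g; rewrite az bz !mul1n.
  exact: (dom_mul (y := (a y, b y)) (w := up (up g)) Ly (Gle true g) Dy (dom_refl _)).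
have /andP[wD {}Hp] : (w \notin D) &&
    path (fun u v => ~~ ((u \in D) && (v \in D))) w r.
  by move: Hp => /=; rewrite zD.
have Hs'' : {in w :: r, forall v, starred v}.
  by move=> v vr; apply: Hs'; rewrite inE vr orbT.
have [|P [Q [PQ Em En Dch]]] := IH w r _ wD Hs'' Hp.
  by move: Hk => /=; lia.
exists (p + P.+1), (q + Q); rewrite !(big_cons _ _ y) !(big_cons _ _ z) Em En my ny mz nz.
rewrite -[last y [:: z, w & r]]/(last w r); split; try lia.
move=> g; apply: (Dmul P.+1 Q (up (up (chain a b g (w :: r))))) => //.
- by rewrite leq_addr.
- have := dom_up2 (Wle P Q _ _) (Dch g).
  rewrite (_ : (3 * _, _) = pmul (star P.+1 Q) (if last w r \in D then up (up g) else up g)) //.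
  by rewrite /pmul /star /= !expnS; congr pair; lia.
by rewrite (chain_cons _ y) (chain_cons _ z) az bz /pmul /up !mul1n.
Qed.
End Chain.

(** * The three types of reduced cycles *)

(* Numbers of independent sets when the cycle consists of two branch vertices of
   weights X and A joined by segments of lengths 2 and 1 (theta1), or 2 and 2
   (theta2), and when it is a triangle of branch vertices. *)
Definition theta1 (X A : nat * nat) : nat := X.1 * (2 * A.1 + A.2) + X.2 * A.1.
Definition theta2 (X A : nat * nat) : nat := X.1 * (4 * A.1 + A.2) + X.2 * (A.1 + A.2).
Definition triangle (X Y A : nat * nat) : nat :=
  X.1 * (Y.1 * (A.1 + A.2) + Y.2 * A.1) + X.2 * (Y.1 * A.1).

(** The left side is the cycle formula cut at [x] with a neighbour of degree 2; [w] and [w'] are the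
    rest of the chain for [x] out and in. The chains are replaced first, then [x], whose new
    coefficients are still decreasing. *)
Lemma theta1_dom x X w w' A : A.2 <= A.1 -> dom x X ->
  dom w (pmul A (up (1, 0))) -> dom w' (pmul A (up (0, 1))) ->
  x.1 * ((up w).1 + (up w).2) + x.2 * (up w').1 <= theta1 X A.
Proof.
case: x X w w' A => [x0 x1] [X0 X1] [w0 w1] [w0' w1'] [A B] /= BA Dx.
rewrite /theta1 /dom /= !muln1 !muln0 => -[H1 H2] [H3 H4].
apply: (@leq_trans (x0 * (2 * A + B) + x1 * A)).
  by apply: leq_add; apply: leq_mul => //; lia.
rewrite ![_ * (2 * A + B)]mulnC ![_ * A]mulnC.
by apply: (dom_context _ Dx); lia.
Qed.

Lemma theta2_dom x X w w' A : A.2 <= A.1 -> dom x X ->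
  dom w (pmul A (up (up (1, 0)))) -> dom w' (pmul A (up (up (0, 1)))) ->
  x.1 * ((up w).1 + (up w).2) + x.2 * (up w').1 <= theta2 X A.
Proof.
case: x X w w' A => [x0 x1] [X0 X1] [w0 w1] [w0' w1'] [A B] /= BA Dx.
rewrite /theta2 /dom /= !muln1 => -[H1 H2] [H3 H4].
apply: (@leq_trans (x0 * (4 * A + B) + x1 * (A + B))).
  by apply: leq_add; apply: leq_mul => //; lia.
rewrite ![_ * (4 * A + B)]mulnC ![_ * (A + B)]mulnC.
by apply: (dom_context _ Dx); lia.
Qed.

Lemma triangle_dom x X y Y w w' A : A.2 <= A.1 -> Y.2 <= Y.1 -> dom x X -> dom y Y ->
  dom w (pmul A (up (1, 0))) -> dom w' (pmul A (up (0, 1))) ->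
  x.1 * (y.1 * (w.1 + w.2) + y.2 * w.1) + x.2 * (y.1 * (w'.1 + w'.2)) <= triangle X Y A.
Proof.
case: x X y Y w w' A => [x0 x1] [X0 X1] [y0 y1] [Y0 Y1] [w0 w1] [w0' w1'] [A B] /=.
move=> BA Y10 Dx Dy; rewrite /triangle /= => -[/= H1 H2] [/= H3 H4].
rewrite !muln1 !muln0 addn0 in H1 H2 H3 H4.
apply: (@leq_trans (x0 * (y1 * A + y0 * (A + B)) + x1 * (y0 * A))).
  apply: leq_add; apply: leq_mul => //; last by apply: leq_mul => //; lia.
  by rewrite addnC; apply: leq_add; apply: leq_mul => //; lia.
apply: (@leq_trans (x0 * (Y1 * A + Y0 * (A + B)) + x1 * (Y0 * A))).
  have := @dom_context (x0 * (A + B) + x1 * A) (x0 * A) _ _ _ Dy => /=.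
  by move=> /(_ ltac:(lia)) H; lia.
have := @dom_context (Y1 * A + Y0 * (A + B)) (Y0 * A) _ _ _ Dx => /=.
by move=> /(_ ltac:(lia)) H; lia.
Qed.

(** * Reduction to the three types *)

Section Bound.
Variables (T : finType) (e : rel T) (s : seq T) (nxt : T -> T) (h : T -> nat).
Hypotheses (us : uniq s) (s3 : 2 < size s) (nxts : {in s, nxt =1 next s})
  (hnxt : forall x, x \notin s -> h (nxt x) < h x)
  (e_nxt : forall x y, e x y = (y == nxt x) || (x == nxt y))
  (e_irr : irreflexive e)
  (deg2_indep : {in deg2 e &, forall u v, ~~ e u v}).

Lemma rot_cycle x : x \in s -> exists t, [/\ perm_eq s (x :: t), uniq (x :: t),
  1 < size t, next s =1 next (x :: t) &
  path (fun u v => ~~ ((u \in deg2 e) && (v \in deg2 e))) x t].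
Proof.
move=> xs; have [i t Es] := rot_to xs; exists t.
have ut : uniq (x :: t) by rewrite -Es rot_uniq.
have pt : perm_eq s (x :: t) by rewrite -Es perm_sym perm_rot.
have nt : next s =1 next (x :: t) by move=> v; rewrite -Es next_rot.
split => //; first by have := s3; rewrite (perm_size pt).
suff : path.cycle (fun u v => ~~ ((u \in deg2 e) && (v \in deg2 e))) (x :: t).
  by rewrite /= rcons_path => /andP[].
apply: (sub_in_cycle (P := mem s) _ _ (cycle_next ut)).
  move=> u v uS _ /eqP <-; apply/negP => /andP[uD vD].
  by have := deg2_indep uD vD; rewrite -nt -nxts // e_nxt eqxx.
by apply/allP => v /=; rewrite -(perm_mem pt).
Qed.

Lemma Zw_rot x t a b : perm_eq s (x :: t) -> uniq (x :: t) -> 1 < size t ->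
  next s =1 next (x :: t) ->
  Zw e [set:: s] a b =
    a x * ((chain a b (1, 0) t).1 + (chain a b (1, 0) t).2) + b x * (chain a b (0, 1) t).1.
Proof.
move=> pt ut t2 nt.
have -> : [set:: s] = [set:: x :: t] by apply/setP => v; rewrite !inE (perm_mem pt) inE.
apply: Zw_next_cycle => //; first exact: functional_sym e_nxt.
move=> u v; rewrite -!(perm_mem pt) => uS vS.
by rewrite e_nxt !nxts // !nt.
Qed.

(** The added constants 1, 2 and 3 count the segments that stay on the reduced cycle; the other
    segments have become pendent paths. *)
Lemma sigma_bound q : #|T| = 2 * #|deg2 e| + q ->
  (exists p1 q1 p2 q2, [/\ 0 < p1 + q1, 0 < p2 + q2, #|deg2 e| = p1 + p2 + 1,
     q = q1 + q2 + 1 & sigma e <= theta1 (star p1 q1) (star p2 q2)]) \/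
  (exists p1 q1 p2 q2, [/\ 0 < p1 + q1, 0 < p2 + q2, #|deg2 e| = p1 + p2 + 2,
     q = q1 + q2 & sigma e <= theta2 (star p1 q1) (star p2 q2)]) \/
  (exists p1 q1 p2 q2 p3 q3, [/\ 0 < p1 + q1, 0 < p2 + q2, 0 < p3 + q3,
     #|deg2 e| = p1 + p2 + p3 /\ q = q1 + q2 + q3 + 3
     & sigma e <= triangle (star p1 q1) (star p2 q2) (star p3 q3)]).
Proof.
move=> ET.
have [|||a [b [m [n [Hab EZ Em En]]]]] := @peel_to_cycle _ e s nxt h us s3 nxts hnxt
  e_nxt e_irr deg2_indep setT (fun=> 1) (fun=> 1) (fun v => (v \in deg2 e) : nat) (fun=> 1).
- by move=> ? _; rewrite inE.
- by move=> ? _; rewrite inE.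
- by move=> w _; apply: peeled_init.
rewrite sigma_Zw EZ.
have {}Em : \sum_(w <- s) m w = #|deg2 e|.
  by rewrite -Em -sum1_card [RHS]big_mkcond; apply: eq_big => w; rewrite ?in_setT //; case: ifP => [->|->].
have {}En : \sum_(w <- s) n w = 2 * #|deg2 e| + q.
  by rewrite -En sum1_card cardsT.
have Hs v : v \in s -> starred (deg2 e) a b m n v.
  move=> vs; rewrite /starred; case: ifP => [vD|/negbT vD].
    by have := peeled_cycle_deg2 us s3 nxts hnxt e_nxt vs vD (Hab v vs).
  by have := peeled_cycle_branch us s3 nxts hnxt e_nxt vs vD (Hab v vs).
have HX v : v \in s -> v \notin deg2 e -> exists p q, [/\ dom (a v, b v) (star p q),
    b v <= a v, m v = p, n v = 2 * p + q + 1 & 0 < p + q].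
  by move=> vs vD; have := Hs v vs; rewrite /starred (negPf vD).
have [/hasP[d ds dD]|nD] := boolP (has (mem (deg2 e)) s).
  have {}dD : d \in deg2 e := dD.
  (* Cut the cycle just before a vertex [d] of degree 2, so that it reads [x], [d], [y] and so on
     with [x] and [y] branch vertices. *)
  pose x := prev s d; have xs : x \in s by rewrite mem_prev.
  have xd : nxt x = d by rewrite nxts // next_prev.
  have xD : x \notin deg2 e.
    by apply/negP => xD; have := deg2_indep xD dD; rewrite e_nxt xd eqxx.
  have [t [pt ut t2 nt Rt]] := rot_cycle xs.
  have Ed : head x t = d by rewrite -xd nxts // nt; case: (t) => [|? ?] /=; rewrite eqxx.
  rewrite (Zw_rot _ _ pt ut t2 nt).
  case: t pt {ut nt} t2 Rt Ed => [|d' [|y r]] // pt _ Rt Ed.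
  have {}Ed : d' = d := Ed; subst d'.
  have /and3P[_ yD Rr] : [&& true, y \notin deg2 e
      & path (fun u v => ~~ ((u \in deg2 e) && (v \in deg2 e))) y r].
    by move: Rt; rewrite /= dD => /and3P[_ -> ->].
  have tS v : v \in y :: r -> v \in s by rewrite (perm_mem pt) !inE => ->; rewrite !orbT.
  have [P [Q [PQ EP EQ Hc]]] := chain_dom yD (fun v vt => Hs v (tS v vt)) Rr.
  have [p1 [q1 [DX LX mx nx pq1]]] := HX x xs xD.
  have := Hs d ds; rewrite /starred dD => -[[ad bd] md nd].
  rewrite (perm_big _ pt) (big_cons _ _ x) (big_cons _ _ d) EP md mx in Em.
  rewrite (perm_big _ pt) (big_cons _ _ x) (big_cons _ _ d) EQ nd nx in En.
  have {Hc} := (Hc (1, 0), Hc (0, 1)).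
  rewrite !(chain_cons _ _ _ d) ad bd.
  move: (chain a b (1, 0) _) (chain a b (0, 1) _) => [w0 w1] [w0' w1'].
  move=> [Hw Hw']; rewrite /pmul /= !mul1n.
  (* The last vertex decides whether the segment returning to [x] has length 2 or 1. *)
  case yl : (last y r \in deg2 e) Hw Hw' => Hw Hw'; rewrite yl /= in Em En.
    right; left; exists p1, q1, P, Q; split=> //; try (clear -Em En; lia).
    exact: theta2_dom (star_le _ _) DX Hw Hw'.
  left; exists p1, q1, P, Q; split=> //; try (clear -Em En; lia).
  exact: theta1_dom (star_le _ _) DX Hw Hw'.
(* Every vertex of the cycle is now a branch vertex: keep two of them and contract the others into a
   third. *)
have {nD} nD v : v \in s -> v \notin deg2 e by move=> vs; apply: contra nD => vD; apply/hasP; exists v.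
have [x xs] : exists x, x \in s by case: (s) s3 => // x ?; exists x; rewrite mem_head.
have [t [pt ut t2 nt Rt]] := rot_cycle xs.
rewrite (Zw_rot _ _ pt ut t2 nt).
case: t pt {ut nt} t2 Rt => [|y [|z r]] // pt _ Rt.
have ys : y \in s by rewrite (perm_mem pt) !inE eqxx orbT.
have tS v : v \in z :: r -> v \in s by rewrite (perm_mem pt) !inE => ->; rewrite !orbT.
have Rr : path (fun u v => ~~ ((u \in deg2 e) && (v \in deg2 e))) z r.
  by move: Rt => /= /and3P[].
have [P [Q [PQ EP EQ Hc]]] := chain_dom (nD z (tS z (mem_head _ _)))
  (fun v vt => Hs v (tS v vt)) Rr.
have zl : last z r \in deg2 e = false by apply/negbTE/nD/tS/mem_last.
have [p1 [q1 [DX LX mx nx pq1]]] := HX x xs (nD x xs).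
have [p2 [q2 [DY LY my ny pq2]]] := HX y ys (nD y ys).
rewrite (perm_big _ pt) (big_cons _ _ x) (big_cons _ _ y) EP my mx zl /= in Em.
rewrite (perm_big _ pt) (big_cons _ _ x) (big_cons _ _ y) EQ ny nx zl /= in En.
have {Hc} := (Hc (1, 0), Hc (0, 1)); rewrite zl.
rewrite !(chain_cons _ _ _ y).
move: (chain a b (1, 0) _) (chain a b (0, 1) _) => [w0 w1] [w0' w1'].
move=> [Hw Hw']; right; right; exists p1, q1, p2, q2, P, Q; split=> //.
  by clear -Em En; split; lia.
exact: triangle_dom (star_le _ _) (star_le _ _) DX DY Hw Hw'.
Qed.
End Bound.

(** * Comparison of the reduced graphs *)

Lemma theta2C X A : theta2 X A = theta2 A X.
Proof. by case: X A => [x0 x1] [a0 a1]; rewrite /theta2 /=; lia. Qed.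

Lemma theta1C X A : theta1 X A = theta1 A X.
Proof. by case: X A => [x0 x1] [a0 a1]; rewrite /theta1 /=; lia. Qed.

(** Each pendent path of length 2 contributes the ratio 2/3 and each of length 1 the ratio 1/2;
    there is at least one path. *)
Lemma star_ratio p q : 0 < p + q -> 3 * (star p q).2 <= 2 * (star p q).1.
Proof.
move=> pq; rewrite /=; case: p pq => [|p] pq.
  by case: q pq => // q _; rewrite expnS; have := expn_gt0 2 q; lia.
have := star_le p q; rewrite /= !expnS; lia.
Qed.

(** All but one path of length 2 move to the other branch vertex. With [(X, Y)] the first star and
    [(A, B)] the moved part, the gain is (A - B)(2X - 3Y). *)
Lemma theta2_le_star p1 q1 p2 q2 : 0 < p1 + q1 -> 0 < p2 ->
  theta2 (star p1 q1) (star p2 q2) <= theta2 (star (p1 + p2.-1) (q1 + q2)) (star 1 0).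
Proof.
case: p2 => // p pq1 _ /=; have := star_ratio pq1; have := star_le p q2.
rewrite -starD /theta2 /pmul /= !expnS.
move: (3 ^ p1 * 2 ^ q1) (2 ^ p1) => X Y.
rewrite -mulnA; move: (3 ^ p * 2 ^ q2) (2 ^ p) => A B AB XY.
have := leq_mul AB XY; nia.
Qed.

(** With a and b the powers of 2 to [q1 - 1] and [q2 - 1], the gain is 2(a - 1)(b - 1); it is the
    same for [theta1] below. *)
Lemma theta2_le_star0 q1 q2 : 0 < q1 -> 0 < q2 ->
  theta2 (star 0 q1) (star 0 q2) <= theta2 (star 0 (q1 + q2).-1) (star 0 1).
Proof.
case: q1 q2 => [|q1] [|q2] // _ _; rewrite addSn addnS /= /theta2 /star /= !expnS !expnD.
have := expn_gt0 2 q1; have := expn_gt0 2 q2.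
by move: (2 ^ q1) (2 ^ q2) => a b; nia.
Qed.

Lemma theta1_le_star0 q1 q2 : 0 < q1 -> 0 < q2 ->
  theta1 (star 0 q1) (star 0 q2) <= theta1 (star 0 (q1 + q2).-1) (star 0 1).
Proof.
case: q1 q2 => [|q1] [|q2] // _ _; rewrite addSn addnS /= /theta1 /star /= !expnS !expnD.
have := expn_gt0 2 q1; have := expn_gt0 2 q2.
by move: (2 ^ q1) (2 ^ q2) => a b; nia.
Qed.

Lemma theta1_le_theta2_1 q1 q2 : 0 < q1 ->
  theta1 (star 0 q1) (star 1 q2) <= theta2 (star 0 (q1 + q2)) (star 0 1).
Proof.
case: q1 => // q1 _; rewrite /theta1 /theta2 /star /= !expnS !expnD ?expnS.
have := expn_gt0 2 q1; have := expn_gt0 2 q2.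
by move: (2 ^ q1) (2 ^ q2) => a b; nia.
Qed.

(** One pendent path of length 2 trades places with the cycle segment of length 1. The mixed terms
    are again controlled by the product (A - B)(2X - 3Y), and the rest has room to spare. *)
Lemma theta1_le_theta2 p1 q1 p2 q2 : 0 < p1 + q1 -> 0 < p2 -> 1 < p1 + p2 ->
  theta1 (star p1 q1) (star p2 q2) <=
    theta2 (star (p1 + p2 - 2) (q1 + q2 + 1)) (star 1 0).
Proof.
case: p2 => // p pq1 _ pp; have := star_ratio pq1; have := star_le p q2.
have := starD p1 q1 p q2.
have -> : p1 + p = (p1 + p.+1 - 2).+1 by lia.
rewrite addn1 starSr !starSl /theta1 /theta2 /pmul [star 0 0]/star.
move: (star p1 q1) (star p q2) (star _ (q1 + q2)) => [X Y] [A B] [C D] /= [E1 E2] AB XY.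
have := leq_mul AB XY; nia.
Qed.

(** [triangle] is the product of the first components plus three terms, each at most 2/3 of that
    product. *)
Lemma triangle_le X Y A : 3 * X.2 <= 2 * X.1 -> 3 * Y.2 <= 2 * Y.1 -> 3 * A.2 <= 2 * A.1 ->
  triangle X Y A <= 3 * (X.1 * Y.1 * A.1).
Proof.
case: X Y A => [X0 X1] [Y0 Y1] [A0 A1] /= HX HY HA; rewrite /triangle /=.
have := leq_mul (leqnn (X0 * Y0)) HA.
have := leq_mul (leqnn (X0 * A0)) HY.
have := leq_mul (leqnn (Y0 * A0)) HX.
nia.
Qed.

Lemma triangle_star_le p1 q1 p2 q2 p3 q3 :
  0 < p1 + q1 -> 0 < p2 + q2 -> 0 < p3 + q3 ->
  triangle (star p1 q1) (star p2 q2) (star p3 q3) <=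
    3 * (3 ^ (p1 + p2 + p3) * 2 ^ (q1 + q2 + q3)).
Proof.
move=> H1 H2 H3; apply: leq_trans (triangle_le _ _ _) _; rewrite ?star_ratio //=.
by rewrite leq_mul2l /= !expnD; lia.
Qed.

Lemma triangle_le_star0 q1 q2 q3 : 0 < q1 -> 0 < q2 -> 0 < q3 ->
  triangle (star 0 q1) (star 0 q2) (star 0 q3) <=
    triangle (star 0 1) (star 0 1) (star 0 (q1 + q2 + q3 - 2)).
Proof.
case: q1 q2 q3 => [|q1] [|q2] [|q3] // _ _ _.
have -> : q1.+1 + q2.+1 + q3.+1 - 2 = (q1 + q2 + q3).+1 by lia.
rewrite /triangle /star /= !expnS !expnD.
have := expn_gt0 2 q1; have := expn_gt0 2 q2; have := expn_gt0 2 q3.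
(* Written in the powers of 2 minus one, the difference of the two sides has nonnegative
   coefficients only. *)
move: (2 ^ q1) (2 ^ q2) (2 ^ q3) => [|a] [|b] [|c] // _ _ _; nia.
Qed.

(* The number of independent sets of the extremal graph with [p] segments of
   length 2 and [q] of length 1. *)
Definition extremal (p q : nat) : nat :=
  match p with
  | 0 => triangle (star 0 1) (star 0 1) (star 0 (q - 5))
  | 1 => theta1 (star 0 (q - 2)) (star 0 1)
  | 2 => theta2 (star 0 q.-1) (star 0 1)
  | p'.+3 => theta2 (star p' q) (star 1 0)
  end.

Lemma theta2_extremal p1 q1 p2 q2 : 0 < p1 + q1 -> 0 < p2 + q2 ->
  theta2 (star p1 q1) (star p2 q2) <= extremal (p1 + p2 + 2) (q1 + q2).
Proof.
move=> H1 H2; rewrite addn2.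
have [E2|p2_gt0] := posnP p2; first have [E1|p1_gt0] := posnP p1; rewrite ?E2.
- by rewrite E1 /= theta2_le_star0 //; lia.
- rewrite theta2C addn0 [q1 + q2]addnC; case: p1 p1_gt0 H1 => // p1 _ _.
  by apply: (@theta2_le_star 0 q2 p1.+1 q1) => //; rewrite E2 in H2.
- case: p2 p2_gt0 H2 => // p2 _ _; rewrite addnS.
  exact: (@theta2_le_star p1 q1 p2.+1 q2).
Qed.

Lemma theta1_extremal p1 q1 p2 q2 : 0 < p1 + q1 -> 0 < p2 + q2 ->
  theta1 (star p1 q1) (star p2 q2) <= extremal (p1 + p2 + 1) (q1 + q2 + 1).
Proof.
wlog p12 : p1 q1 p2 q2 / p1 <= p2.
  move=> H H1 H2; have [|/ltnW] := leqP p1 p2; first by move/H; apply.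
  by move/H => {}H; rewrite theta1C [p1 + p2]addnC [q1 + q2]addnC H.
move=> H1 H2; have [E|p2_gt0] := posnP p2.
  have E1 : p1 = 0 by lia.
  rewrite E E1 /= (_ : q1 + q2 + 1 - 2 = (q1 + q2).-1); last by lia.
  by rewrite theta1_le_star0 //; lia.
have [lt1|] := ltnP 1 (p1 + p2).
  have -> : p1 + p2 + 1 = (p1 + p2 - 2).+3 by lia.
  exact: theta1_le_theta2.
move=> le1; have [-> E2] : p1 = 0 /\ p2 = 1 by lia.
by rewrite E2 /= addn1 theta1_le_theta2_1 //; lia.
Qed.

Lemma triangle_extremal p1 q1 p2 q2 p3 q3 :
  0 < p1 + q1 -> 0 < p2 + q2 -> 0 < p3 + q3 ->
  triangle (star p1 q1) (star p2 q2) (star p3 q3) <=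
    extremal (p1 + p2 + p3) (q1 + q2 + q3 + 3).
Proof.
move=> H1 H2 H3; have [E|pgt0] := posnP (p1 + p2 + p3).
  have [E1 E2 E3] : [/\ p1 = 0, p2 = 0 & p3 = 0] by split; lia.
  rewrite E1 E2 E3 /= (_ : _ + 3 - 5 = q1 + q2 + q3 - 2); last by lia.
  by rewrite triangle_le_star0 //; lia.
(* As soon as a segment of length 2 exists, the crude bound suffices: the leading coefficients are 9
   against 10, 27 against 36, and 81 against 112. *)
apply: leq_trans (triangle_star_le H1 H2 H3) _.
move: (p1 + p2 + p3) (q1 + q2 + q3) pgt0 => p q; case: p => [|[|[|p]]] // _.
- rewrite /= (_ : q + 3 - 2 = q.+1); last by lia.
  by rewrite /theta1 /star /= !expnS !expn0; lia.
- by rewrite /= addn3 /theta2 /star /= !expnS ?expn0; lia.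
- by rewrite /= addn3 /theta2 /star /= !expnS ?expn0; lia.
Qed.

(** * The extremal graphs *)

Lemma erel_sym n E : symmetric (@erel n E).
Proof. by move=> i j; rewrite /erel orbC. Qed.

Lemma erel_irr n E : (forall i, (i, i) \notin E) -> irreflexive (@erel n E).
Proof. by move=> H i; rewrite /erel (negPf (H _)). Qed.

Lemma pend_edges_range w o s u v : (u, v) \in pend_edges w o s -> o <= v < o + sumn s.
Proof.
elim: s o => //= l s IH o; rewrite mem_cat => /orP[|/IH]; last by lia.
case: l => [|l] //=; rewrite inE => /predU1P[[_ ->]|/mapP[i]]; first by lia.
by rewrite mem_iota => Hi [_ ->]; lia.
Qed.

Section Initial.
Variables (n : nat) (E : seq (nat * nat)).
Hypothesis E_irr : forall i, (i, i) \notin E.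

(** The concrete graphs number their pendent vertices after the cycle, path by path outwards, so
    peeling always removes the last vertex and leaves an initial segment. *)
Definition Zn (k : nat) (a b : nat -> nat) : nat :=
  Zw (@erel n E) [set i : 'I_n | i < k] (fun i => a i) (fun i => b i).

Lemma eq_Zn k a b a' b' : (forall i, i < k -> a i = a' i) ->
  (forall i, i < k -> b i = b' i) -> Zn k a b = Zn k a' b'.
Proof. by move=> Ha Hb; apply: eq_Zw => i; rewrite inE => ik; rewrite ?Ha ?Hb. Qed.

Lemma Zn_peel k u a b : k < n -> u < k ->
  (forall j, j <= k -> ((k, j) \in E) || ((j, k) \in E) = (j == u)) ->
  Zn k.+1 a b = Zn k (upd a u (a u * (a k + b k))) (upd b u (b u * a k)).
Proof.
move=> kn uk H; have un := ltn_trans uk kn.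
rewrite /Zn (@Zw_peel _ _ (@erel_sym n E) (erel_irr E_irr) _ _ _ (Ordinal un) (Ordinal kn)).
- rewrite (_ : _ :\ _ = [set i : 'I_n | i < k]).
    by apply: eq_Zw => i _; rewrite /upd -val_eqE.
  by apply/setP => i; rewrite !inE -val_eqE /=; lia.
- by rewrite inE /=; lia.
- by rewrite inE /=.
- by move=> j; rewrite inE ltnS => jk; rewrite /erel /= H // -val_eqE.
Qed.

(** The later paths have larger numbers, so the induction removes them first and then peels the
    first path from its tip. *)
Lemma Zn_pend w o s a b : w < o -> o + sumn s <= n ->
  all (fun l => (l == 1) || (l == 2)) s ->
  (forall k j, o <= k < o + sumn s -> j <= k ->
    ((k, j) \in E) || ((j, k) \in E) = ((j, k) \in pend_edges w o s)) ->
  (forall k, o <= k < o + sumn s -> a k = 1 /\ b k = 1) ->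
  let x := star (count_mem 2 s) (count_mem 1 s) in
  Zn (o + sumn s) a b = Zn o (upd a w (a w * x.1)) (upd b w (b w * x.2)).
Proof.
elim: s o a b => [|l s IH] o a b wo on.
  move=> _ _ _ /=; rewrite addn0 !muln1.
  by apply: eq_Zn => i _; rewrite /upd; case: eqP => // ->.
move=> /= /andP[l12 s12] HE Hab; rewrite addnA.
rewrite IH //; try (rewrite /= in on; lia); first last.
- by move=> k Hk; apply: Hab; lia.
- move=> k j Hk jk; rewrite HE //; last by lia.
  rewrite mem_cat; case: (boolP ((j, k) \in ppath_edges w o l)) => //.
  case: (l) Hk => [|l'] //= Hk; rewrite inE => /predU1P[[_ Ek]|/mapP[i]]; first by lia.
  by rewrite mem_iota => Hi [_ Ek]; lia.
have HE' k j : o <= k < o + l -> j <= k ->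
    ((k, j) \in E) || ((j, k) \in E) = ((j, k) \in ppath_edges w o l).
  move=> Hk jk; rewrite HE //; last by lia.
  rewrite mem_cat; case: (boolP ((j, k) \in pend_edges _ _ _)); rewrite ?orbF //.
  by move/pend_edges_range; lia.
have wo' : (o == w) = false by lia.
set P := count_mem 2 s; set Q := count_mem 1 s.
have [ao bo] : a o = 1 /\ b o = 1 by apply: Hab; lia.
case/orP: l12 => /eqP El; rewrite El /= in on HE' Hab *.
  rewrite addn1 (@Zn_peel o w) //; try lia; last first.
    by move=> j jo; rewrite HE' ?inE ?xpair_eqE ?eqxx ?andbT //; lia.
  apply: eq_Zn => i io; rewrite /upd eqxx wo' ?ao ?bo; case: eqP => // _.
  - by rewrite -/P -/Q add0n add1n expnS; lia.
  - by rewrite -/P -/Q add0n muln1.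
have [ao1 bo1] : a o.+1 = 1 /\ b o.+1 = 1 by apply: Hab; lia.
have wo1 : (o.+1 == w) = false by lia.
rewrite addn2 (@Zn_peel o.+1 o) //; try lia; last first.
  move=> j jo; rewrite HE' ?inE ?xpair_eqE ?addn0 ?addn1 ?eqxx ?andbT //; last by lia.
  by rewrite (_ : (o.+1 == o) = false) ?andbF //; lia.
rewrite (@Zn_peel o w) //; try lia; last first.
  move=> j jo; rewrite HE' ?inE ?xpair_eqE ?addn0 ?addn1 ?eqxx ?andbT //; last by lia.
  by rewrite (_ : (o == o.+1) = false) ?andbF ?orbF //; lia.
have wo2 : (w == o) = false by lia.
apply: eq_Zn => i io; rewrite /upd ?eqxx ?wo' ?wo1 ?wo2 ?ao ?bo ?ao1 ?bo1; case: eqP => [_|_].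
- by rewrite -/P -/Q add0n add1n expnS; lia.
- by rewrite (_ : (i == o) = false) //; lia.
- by rewrite -/P -/Q add1n expnS; lia.
- by rewrite (_ : (i == o) = false) //; lia.
Qed.

Lemma Zn_triangle a b : 2 < n ->
  (forall i j, i < 3 -> j < 3 ->
    ((i, j) \in E) || ((j, i) \in E) = (j == i.+1 %% 3) || (i == j.+1 %% 3)) ->
  Zn 3 a b = triangle (a 0, b 0) (a 1, b 1) (a 2, b 2).
Proof.
move=> n3 H.
have [n0 n1] : 0 < n /\ 1 < n by split; lia.
pose o0 : 'I_n := Ordinal n0; pose o1 : 'I_n := Ordinal n1; pose o2 : 'I_n := Ordinal n3.
have -> : Zn 3 a b = Zw (@erel n E) [set:: [:: o0, o1 & rcons [::] o2]] (fun i => a i) (fun i => b i).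
  congr (Zw _ _ _ _); apply/setP => i; rewrite !inE -!val_eqE /=.
  by case: i => -[|[|[|i]]].
rewrite (Zw_cycle (@erel_sym n E) (erel_irr E_irr)) //; last first.
- by move=> w; rewrite !inE => /orP[]/eqP->; rewrite /erel H //= -!val_eqE.
- by rewrite /= /erel H.
by rewrite /triangle /=; lia.
Qed.

Lemma Zn_square a b : 3 < n ->
  (forall i j, i < 4 -> j < 4 ->
    ((i, j) \in E) || ((j, i) \in E) = (j == i.+1 %% 4) || (i == j.+1 %% 4)) ->
  a 1 = 1 -> b 1 = 1 -> a 3 = 1 -> b 3 = 1 ->
  Zn 4 a b = theta2 (a 0, b 0) (a 2, b 2).
Proof.
move=> n4 H a1 b1 a3 b3.
have [n0 n1 n2] : [/\ 0 < n, 1 < n & 2 < n] by split; lia.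
pose o0 : 'I_n := Ordinal n0; pose o1 : 'I_n := Ordinal n1.
pose o2 : 'I_n := Ordinal n2; pose o3 : 'I_n := Ordinal n4.
have -> : Zn 4 a b = Zw (@erel n E) [set:: [:: o0, o1 & rcons [:: o2] o3]] (fun i => a i) (fun i => b i).
  congr (Zw _ _ _ _); apply/setP => i; rewrite !inE -!val_eqE /=.
  by case: i => -[|[|[|[|i]]]].
rewrite (Zw_cycle (@erel_sym n E) (erel_irr E_irr)) //; last first.
- by move=> w; rewrite !inE => /or3P[]/eqP->; rewrite /erel H //= -!val_eqE.
- by rewrite /= /erel !H.
by rewrite /theta2 /= a1 b1 a3 b3; lia.
Qed.
End Initial.

Lemma pend_edges_lt w o s u v : w < o -> (u, v) \in pend_edges w o s -> u < v.
Proof.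
elim: s o => //= l s IH o wo; rewrite mem_cat => /orP[|/IH]; last by apply; lia.
case: l => [|l] //=; rewrite inE => /predU1P[[-> ->] //|/mapP[i _ [-> ->]]].
by lia.
Qed.

Lemma mem_cyc_edges c i j : ((i, j) \in cyc_edges c) = (i < c) && (j == i.+1 %% c).
Proof.
apply/mapP/andP => [[k]|[ic /eqP->]]; last by exists i; rewrite // mem_iota.
by rewrite mem_iota => kc [-> ->].
Qed.

(* A pair (w, s) stands for pendent paths of lengths s attached at the vertex w. *)
Fixpoint bunches (o : nat) (ps : seq (nat * seq nat)) : seq (nat * nat) :=
  if ps is (w, s) :: ps' then pend_edges w o s ++ bunches (o + sumn s) ps' else [::].

Definition bunches_size (ps : seq (nat * seq nat)) : nat := sumn [seq sumn p.2 | p <- ps].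

Definition attach (ps : seq (nat * seq nat)) (w : nat) : nat * nat :=
  foldr (fun p x => if w == p.1 then pmul x (star (count_mem 2 p.2) (count_mem 1 p.2)) else x)
    (1, 1) ps.

Lemma bunches_range c o ps u v : c <= o -> all (fun p => p.1 < c) ps ->
  (u, v) \in bunches o ps -> [/\ u < v, o <= v & v < o + bunches_size ps].
Proof.
elim: ps o => //= -[w s] ps IH o co /andP[/= wc wps].
rewrite /bunches_size /= -/(bunches_size ps) mem_cat => /orP[H|/IH].
  have := pend_edges_range H; have := pend_edges_lt (leq_trans wc co) H.
  by split; lia.
by case=> //; [lia|split=> //; lia].
Qed.

Lemma Zn_bunches n E c o ps : (forall i, (i, i) \notin E) -> c <= o ->
  all (fun p => (p.1 < c) && all (fun l => (l == 1) || (l == 2)) p.2) ps ->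
  o + bunches_size ps <= n ->
  (forall k j, o <= k < o + bunches_size ps -> j <= k ->
    ((k, j) \in E) || ((j, k) \in E) = ((j, k) \in bunches o ps)) ->
  Zn n E (o + bunches_size ps) (fun=> 1) (fun=> 1) =
  Zn n E o (fun w => (attach ps w).1) (fun w => (attach ps w).2).
Proof.
move=> E_irr; elim: ps o => [|[w s] ps IH] o co.
  by move=> _ _ _; rewrite /bunches_size /= addn0.
rewrite /bunches_size /= -/(bunches_size ps) => /andP[/andP[/= wc s12] Hps] on HE.
have wps : all (fun p => p.1 < c) ps by apply: sub_all Hps => p /andP[].
have out k : c <= k -> attach ps k = (1, 1).
  elim: (ps) wps => //= p ps' IHp /andP[pc pc'] ck; rewrite IHp //.
  by case: eqP => // Ek; lia.
rewrite addnA IH //; [|lia|lia|]; last first.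
  move=> k j Hk jk; rewrite HE ?mem_cat //; last by lia.
  case: (boolP ((j, k) \in pend_edges _ _ _)) => // /pend_edges_range; lia.
rewrite (@Zn_pend n E E_irr w); [|lia|lia|done| |].
- by apply: eq_Zn => i _; rewrite /upd; case: eqP => // ->.
- move=> k j Hk jk; rewrite HE ?mem_cat //; last by lia.
  case: (boolP ((j, k) \in bunches _ _)); rewrite ?orbF //.
  by move/(bunches_range (leq_trans co (leq_addr _ _)) wps) => []; lia.
- by move=> k Hk; rewrite out //; lia.
Qed.

Section CycleBunches.
Variables (n c : nat) (ps : seq (nat * seq nat)).
Hypotheses (c_gt1 : 1 < c) (En : n = c + bunches_size ps)
  (Hps : all (fun p => (p.1 < c) && all (fun l => (l == 1) || (l == 2)) p.2) ps).

Let E := cyc_edges c ++ bunches c ps.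

Let range u v (H : (u, v) \in bunches c ps) : [/\ u < v, c <= v & v < c + bunches_size ps].
Proof.
apply: (bunches_range (leqnn c)) H.
by apply: sub_all Hps => p /andP[].
Qed.

Lemma cycle_bunches_irr i : (i, i) \notin E.
Proof.
rewrite mem_cat mem_cyc_edges negb_or; apply/andP; split; last by apply/negP => /range[]; lia.
apply/negP => /andP[ic /eqP]; have [Ec|ic'] := eqVneq i.+1 c; first by rewrite Ec modnn; lia.
by rewrite modn_small; lia.
Qed.

Lemma cycle_bunches_core i j : i < c -> j < c ->
  ((i, j) \in E) || ((j, i) \in E) = (j == i.+1 %% c) || (i == j.+1 %% c).
Proof.
move=> ic jc; rewrite !mem_cat !mem_cyc_edges ic jc /=.
have no u v : v < c -> (u, v) \in bunches c ps = false.
  by move=> vc; apply/negP => /range[]; lia.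
by rewrite !no // !orbF.
Qed.

Lemma sigma_cycle_bunches : sigma (@erel n E) =
  Zn n E c (fun w => (attach ps w).1) (fun w => (attach ps w).2).
Proof.
rewrite sigma_Zw -(@Zn_bunches n E c c) //; try exact: cycle_bunches_irr; last 2 first.
- by rewrite En.
- move=> k j Hk jk; rewrite !mem_cat !mem_cyc_edges ltnNge.
  have -> /= : c <= k by case/andP: Hk.
  case: (boolP ((k, j) \in bunches _ _)) => [/range[]|_]; first by lia.
  have km : k == j.+1 %% c = false.
    by have := ltn_pmod j.+1 (ltnW c_gt1); case: eqP => //; lia.
  by rewrite km andbF.
rewrite -En /Zn; congr (Zw _ _ _ _).
by apply/setP => i; rewrite !inE ltn_ord.
Qed.
End CycleBunches.

Definition short (s : seq nat) := all (fun l => (l == 1) || (l == 2)) s.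

Lemma sigma_Uab22 s r : short s -> short r -> sigma (Uab 2 2 s r) =
  theta2 (star (count_mem 2 s) (count_mem 1 s)) (star (count_mem 2 r) (count_mem 1 r)).
Proof.
move=> Hs Hr; pose ps := [:: (0, s); (2, r)].
have En : Uab_n 2 2 s r = 4 + bunches_size ps by rewrite /Uab_n /bunches_size /=; lia.
have Hps : all (fun p => (p.1 < 4) && all (fun l => (l == 1) || (l == 2)) p.2) ps.
  by rewrite /= -!/(short _) Hs Hr.
have -> : Uab 2 2 s r = @erel (Uab_n 2 2 s r) (cyc_edges 4 ++ bunches 4 ps).
  by rewrite /Uab /= cats0.
rewrite (sigma_cycle_bunches _ En) // Zn_square //.
- by rewrite /= /theta2 /pmul /=; lia.
- exact: cycle_bunches_irr.
- exact: cycle_bunches_core.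
Qed.

(** This is a triangle whose middle vertex 1 carries nothing: [triangle] with weights [(1, 1)] there
    equals [theta1]. *)
Lemma sigma_Uab21 s r : short s -> short r -> sigma (Uab 2 1 s r) =
  theta1 (star (count_mem 2 s) (count_mem 1 s)) (star (count_mem 2 r) (count_mem 1 r)).
Proof.
move=> Hs Hr; pose ps := [:: (0, s); (2, r)].
have En : Uab_n 2 1 s r = 3 + bunches_size ps by rewrite /Uab_n /bunches_size /=; lia.
have Hps : all (fun p => (p.1 < 3) && all (fun l => (l == 1) || (l == 2)) p.2) ps.
  by rewrite /= -!/(short _) Hs Hr.
have -> : Uab 2 1 s r = @erel (Uab_n 2 1 s r) (cyc_edges 3 ++ bunches 3 ps).
  by rewrite /Uab /= cats0.
rewrite (sigma_cycle_bunches _ En) // Zn_triangle //.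
- by rewrite /= /theta1 /triangle /pmul /=; lia.
- exact: cycle_bunches_irr.
- exact: cycle_bunches_core.
Qed.

Lemma pend_edges_nseq w o k : pend_edges w o (nseq k 1) = [seq (w, i) | i <- iota o k].
Proof. by elim: k o => //= k IH o; rewrite IH addn1. Qed.

Lemma sigma_U1 n : 5 <= n -> sigma (U1 n) =
  triangle (star 0 1) (star 0 1) (star 0 (n - 5)).
Proof.
move=> n5; pose ps := [:: (0, [:: 1]); (1, [:: 1]); (2, nseq (n - 5) 1)].
have En : n = 3 + bunches_size ps.
  by rewrite /bunches_size /= sumn_nseq; lia.
have Hps : all (fun p => (p.1 < 3) && all (fun l => (l == 1) || (l == 2)) p.2) ps.
  by rewrite /= all_nseq orbT.
have -> : U1 n = @erel n (cyc_edges 3 ++ bunches 3 ps).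
  by rewrite /U1 /= pend_edges_nseq cats0.
rewrite (sigma_cycle_bunches _ En) // Zn_triangle //.
- by rewrite /= !count_nseq /= mul0n mul1n /triangle /pmul /star /= !mul1n !addn0.
- exact: cycle_bunches_irr.
- by lia.
- exact: cycle_bunches_core.
Qed.

Theorem theorem7 (T : finType) (e : rel T) (l : seq nat) :
  symmetric e -> irreflexive e -> unicyclic e -> segseq e l ->
  nth 0 l 0 <= 2 ->
  (nth 0 l 0 = 2 -> 4 <= size l ->
     sigma e <= sigma (Uab (nth 0 l 0) (nth 0 l 1) (drop 3 l) [:: nth 0 l 2])) /\
  (nth 0 l 0 = 1 -> 6 <= size l -> sigma e <= sigma (U1 (size l))).
Proof.
move=> e_sym e_irr uni sl l2.
have [l0|l_gt0] := posnP (size l); first by rewrite l0.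
have [s [nxt [h [us s3 nxts hnxt e_nxt]]]] := unicyclic_functional e_sym e_irr uni.
(* Two adjacent vertices of degree 2 would give a segment with at least 3 edges. The endpoint [x0]
   of some segment provides a vertex not of degree 2, as [deg2_not_adjacent] requires. *)
have indep : {in deg2 e &, forall u v, ~~ e u v}.
  have [L [uL HL sorted_l pl]] := sl.
  have sz : size L = size l by rewrite (perm_size pl) size_map.
  have [E0 /HL [x0 [p0 [/and5P[_ _ _ _ /and4P[_ dx0 _ _]] _]]]] : exists E, E \in L.
    by case: (L) sz l_gt0 => [/= <-|E L' _ _] //; exists E; rewrite mem_head.
  move=> u v; rewrite !inE => /eqP du /eqP dv.
  apply: (@deg2_not_adjacent _ _ e_sym e_irr uni.1 x0) => //; first by lia.
  move=> E /HL EL; have : #|E| \in l by rewrite (perm_mem pl); apply: map_f.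
  case: (l) sorted_l l2 => //= k l' sl' k2; rewrite inE => /predU1P[->//|kl].
  have := allP (order_path_min (fun a b c ba ac => leq_trans ac ba) sl') _ kl.
  by move/leq_trans; apply.
have [q [ET El]] := segseq_nseq us s3 nxts hnxt e_nxt e_irr indep sl.
have bound : sigma e <= extremal #|deg2 e| q.
  have := sigma_bound us s3 nxts hnxt e_nxt e_irr indep ET.
  case=> [[p1 [q1 [p2 [q2 [H1 H2 -> -> H]]]]]|].
    exact: leq_trans H (theta1_extremal H1 H2).
  case=> [[p1 [q1 [p2 [q2 [H1 H2 -> -> H]]]]]|].
    exact: leq_trans H (theta2_extremal H1 H2).
  case=> [p1 [q1 [p2 [q2 [p3 [q3 [H1 H2 H3 [-> ->] H]]]]]]].
  exact: leq_trans H (triangle_extremal H1 H2 H3).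
move: #|deg2 e| El bound => p ->{l sl l2 l_gt0 ET}.
rewrite size_cat !size_nseq => bound; split.
  have short_cat p' q' : short (nseq p' 2 ++ nseq q' 1).
    by rewrite /short all_cat !all_nseq !orbT.
  have short1 q' : short (nseq q' 1) by rewrite /short all_nseq orbT.
  (* With [p] entries 2 followed by [q] entries 1, the cases [p = 1], [p = 2] and [p >= 3] decide
     [l_2] and [l_3], hence the cycle length and the lone path at the second vertex, in step with
     [extremal]. *)
  case: p bound => [|[|[|p]]] bound; first by case: q {bound}.
  - case: q bound => [|[|[|q]]] // bound _ _; rewrite /= ?drop0 sigma_Uab21 //; last exact: (short1 q.+1).
    by move: bound; rewrite /= !count_nseq /= !subSS subn0 mul0n mul1n.
  - case: q bound => [|[|q]] // bound _ _; rewrite /= ?drop0 sigma_Uab22 //; last exact: (short1 q.+1).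
    by move: bound; rewrite /= !count_nseq /= mul0n mul1n.
  - move=> _ _; rewrite /= ?drop0 sigma_Uab22 //.
    by move: bound; rewrite /= !count_cat !count_nseq /= !mul0n !mul1n addn0.
case: p bound => [|p] // bound _ H; rewrite sigma_U1 //.
by apply: leq_trans H.
Qed.
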